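(* There is an absolute constant $C>0$ such that for every $\varepsilon>0$ there exist constants $p_0=p_0(\varepsilon)$ and $c=c(\varepsilon)>0$, depending only on $\varepsilon$, such that for every prime $p\ge p_0$, every integer $M$ with $1\le M\le p$, every integer $\lambda$ with $\gcd(\lambda,p)=1$, and all integers $K,L$, the following hold: $$I_2(M;K,L)\le C\,\frac{M^2}{p}+c\,M^{4/5+\varepsilon},$$ and, in the case $K=L$, $$I_2(M;L,L)\le C\,\frac{M^2}{p}+c\,M^{3/4+\varepsilon}.$$
   Context: For a prime $p$, integers $K,L,\lambda$ with $\gcd(\lambda,p)=1$ and an integer $1\le M\le p$, $I_2(M;K,L)$ denotes the number of pairs of integers $(x,y)$ with $xy\equiv\lambda\pmod p$, $K+1\le x\le K+M$, $L+1\le y\le L+M$. *)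

(* Defs.v *)
From mathcomp Require Import all_boot all_order all_algebra finmap.
From mathcomp Require Import boolp classical_sets functions cardinality reals exp.
Set Implicit Arguments.
Unset Strict Implicit.
Unset Printing Implicit Defensive.
Import Order.TTheory GRing.Theory Num.Theory.
Local Open Scope classical_set_scope.
Local Open Scope ring_scope.

Definition hyperbola_box (p : nat) (lam : int) (M : nat) (K L : int) :
    set (int * int) :=
  [set z | [/\ (z.1 * z.2 = lam %[mod p])%Z,
               K + 1 <= z.1 <= K + M%:Z &
               L + 1 <= z.2 <= L + M%:Z]].

(* [fset_set] sends infinite sets to the empty set by convention; this lemma
   shows that the convention never applies in [I2]. *)
Lemma finite_hyperbola_box (p : nat) (lam : int) (M : nat) (K L : int) :
  finite_set (hyperbola_box p lam M K L).
Proof.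
pose f (k : nat * nat) : int * int := (K + 1 + k.1%:Z, L + 1 + k.2%:Z).
apply: (@sub_finite_set _ _ (f @` (`I_M `*` `I_M))); last first.
  by apply: finite_image; apply: finite_setX; exact: finite_II.
have shift (A x : int) : A + 1 <= x <= A + M%:Z ->
    exists2 k : nat, (k < M)%N & A + 1 + k%:Z = x.
  move=> /andP[lo hi].
  have h0 : 0 <= x - (A + 1) by rewrite subr_ge0.
  exists `|(x - (A + 1))%R|%N; last by rewrite gez0_abs // addrC subrK.
  by rewrite -ltz_nat gez0_abs // ltrBlDr addrA ltzD1 [_ + A]addrC.
move=> [x y] [/= _ /shift[i iM Ei] /shift[j jM Ej]].
by exists (i, j) => //; rewrite /f /= Ei Ej.
Qed.

Definition I2 (p : nat) (lam : int) (M : nat) (K L : int) : nat :=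
  #|` fset_set (hyperbola_box p lam M K L)|%fset.

(* Main.v *)
Require Import Defs.
From HB Require Import structures.
From mathcomp Require Import all_boot all_order all_algebra all_field qpoly.
From mathcomp Require Import reals exp.
From mathcomp Require Import zify ring lra.
Set Implicit Arguments.
Unset Strict Implicit.
Unset Printing Implicit Defensive.
Import Order.TTheory GRing.Theory Num.Theory.
Local Open Scope ring_scope.

(** For [M] large, count with a Fejer weight and the Weil bound
    [|Kl(h, k; p)| <= 2 sqrt p]: this gives [I2 <= 4 M^2/p + (9/2) sqrt p].
    For [M] small, multiply the congruence [x y + L x + K y = lam'] by an
    integer [t] making [t K] and [t L] small modulo [p] (Dirichlet); it then
    lifts to few integral equations [(t x + v) (t y + u) = n], each with few
    solutions by the divisor bound.  When [p > 4 M^4] the divisor bound would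
    lose powers of [p], but there three points of the modular hyperbola
    determine an integral hyperbola with coefficients polynomial in [M] which
    contains all the others.  The two ranges meet at [M = p^(5/8)], and at
    [M = p^(2/3)] if [K = L], where one multiplier suffices.

    The Weil bound is obtained through the Kloosterman sums [S_n] over the
    fields with [p^n] elements.  Summing the multiplicative function
    [psi (- c_(d-1) - a c_1 / c_0)] over monic polynomials shows that [S_n]
    satisfies the recurrence [S_n = - S_1 S_(n-1) - p S_(n-2)] (the L-function
    has degree 2), while Bombieri's form of Stepanov's method on the curves
    [y^p - y + b = x + a / x] gives [S_n = O(p^(n/2))] for even [n], with a
    constant depending on [p].  This growth rate is incompatible with
    [S_1^2 > 4 p]. *)

(** * Reduction modulo a curve with leading form z^p - x^(p+1) *)

(** The curve has a single point at infinity, where [x] has a pole of order [p] and [z = x * y] one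
    of order [p.+1]. Weights of polynomials stand for pole orders, and counting over the finite
    field [L] stands for the dimension estimates of Riemann-Roch; both use only the leading form of
    the curve. The price, error terms that grow with [p], is harmless because [p] stays fixed while
    [n] tends to infinity. The restriction to even [n] comes from the auxiliary function, which
    exploits [x ^+ (Q ^ 2) = x] on a field with [Q ^ 2] elements. Even [n] suffice: [S_1^2 > 4 p]
    would make the two inverse roots of the L-function real, of product [p] and of different
    absolute values, so that the square of one of them would exceed [p]. *)

Lemma coefM_top (A : nzRingType) (f g : {poly A}) (m n : nat) :
  (size f <= m.+1)%N -> (size g <= n.+1)%N -> (f * g)`_(m + n) = f`_m * g`_n.
Proof.
move=> sf sg; rewrite coefM.
have mP : (m < (m + n).+1)%N by rewrite ltnS leq_addr.
rewrite (bigD1 (Ordinal mP)) //= addKn big1 ?addr0 // => i.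
rewrite -val_eqE /= neq_ltn => /orP[lt|gt].
- by rewrite [g`__]nth_default ?mulr0 //; apply: leq_trans sg _; lia.
- by rewrite nth_default ?mul0r //; exact: leq_trans sf gt.
Qed.

Section Weight.
Import Pdiv.Ring Pdiv.RingMonic.
Variables (L : comNzRingType) (p : nat).
Implicit Types F G : {poly {poly L}}.

(* The inner variable [x] has weight [p] and the outer variable [z] has weight
   [p.+1].  [wlead] substitutes ['X^p] and ['X^(p.+1)] for them, so that the
   leading form of weight [N] becomes the coefficient of ['X^N]; monomials of
   degree less than [p] in [z] have distinct weights. *)
Record wle N F : Prop := Wle
  { wle_coef : forall i j, (N < p * i + p.+1 * j)%N -> F`_j`_i = 0 }.

Definition wlead F : {poly L} := (map_poly (comp_poly 'X^p) F).['X^(p.+1)].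

Lemma wleadB F G : wlead (F - G) = wlead F - wlead G.
Proof. by rewrite /wlead rmorphB hornerD hornerN. Qed.

Lemma wleadM F G : wlead (F * G) = wlead F * wlead G.
Proof. by rewrite /wlead rmorphM hornerM. Qed.

Lemma wlead_sum I (r : seq I) (P : pred I) (E : I -> {poly {poly L}}) :
  wlead (\sum_(i <- r | P i) E i) = \sum_(i <- r | P i) wlead (E i).
Proof. by rewrite /wlead rmorph_sum horner_sum. Qed.

Lemma wlead1 : wlead 1 = 1.
Proof. by rewrite /wlead rmorph1 hornerC. Qed.

Lemma wleadE F : wlead F = \sum_(j < size F) \sum_(i < size F`_j)
   F`_j`_i *: 'X^(p * i + p.+1 * j).
Proof.
rewrite /wlead map_polyE.
rewrite (@horner_coef_wide _ (size F)); last first.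
  by rewrite (leq_trans (size_Poly _)) // size_map.
apply: eq_bigr => j _; rewrite coef_Poly (nth_map 0) //.
rewrite /comp_poly /= (@horner_coef_wide _ (size F`_j)) ?size_map_polyC //.
rewrite mulr_suml; apply: eq_bigr => i _.
by rewrite coef_map /= -!exprM -mulrA -exprD mul_polyC.
Qed.

Lemma wle0 N : wle N 0. Proof. by split=> i j _; rewrite !coef0. Qed.

Lemma wleW M N F : (M <= N)%N -> wle M F -> wle N F.
Proof. by move=> MN FM; split=> i j Nij; apply: (wle_coef FM); apply: leq_ltn_trans Nij. Qed.

Lemma wleD N F G : wle N F -> wle N G -> wle N (F + G).
Proof. by move=> [FN] [GN]; split=> i j h; rewrite !coefD FN ?GN ?addr0. Qed.

Lemma wleN N F : wle N F -> wle N (- F).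
Proof. by move=> [FN]; split=> i j h; rewrite !coefN FN ?oppr0. Qed.

Lemma wleB N F G : wle N F -> wle N G -> wle N (F - G).
Proof. by move=> FN GN; apply: wleD => //; apply: wleN. Qed.

Lemma wle_sum N I (r : seq I) (P : pred I) (E : I -> {poly {poly L}}) :
  (forall i, P i -> wle N (E i)) -> wle N (\sum_(i <- r | P i) E i).
Proof. by move=> EN; elim/big_ind: _ => //; [exact: wle0 | exact: wleD]. Qed.

Lemma wleM M N F G : wle M F -> wle N G -> wle (M + N) (F * G).
Proof.
move=> [FM] [GN]; split=> i j h; rewrite coefM coef_sum big1 // => j' _.
rewrite coefM big1 // => i' _.
have [?|?] := ltnP M (p * i' + p.+1 * j'); first by rewrite FM ?mul0r.
rewrite [X in _ * X]GN ?mulr0 //; have := ltn_ord i'; have := ltn_ord j'.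
nia.
Qed.

Lemma wle_monom i j (c : L) : wle (p * i + p.+1 * j) ((c *: 'X^i)%:P * 'X^j).
Proof.
split=> i' j' h; rewrite coefCM coefXn.
case: eqP => [j'E|_]; last by rewrite mulr0 coef0.
rewrite mulr1 coefZ coefXn; case: eqP => [i'E|_]; last by rewrite mulr0.
by move: h; rewrite j'E i'E ltnn.
Qed.

Lemma wleXn N F n : wle N F -> wle (n * N) (F ^+ n).
Proof.
move=> FN; elim: n => [|n IH]; last by rewrite exprS mulSn; exact: wleM.
rewrite mul0n expr0; split=> i [|j] h; rewrite coef1 /= ?coef0 //.
by case: i h => [|i] h; rewrite coef1 // !muln0 in h *.
Qed.

Lemma size_wlead N F : wle N F -> (size (wlead F) <= N.+1)%N.
Proof.
move=> [FN]; rewrite wleadE; apply/leq_sizeP => k Nk.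
rewrite coef_sum big1 // => j _; rewrite coef_sum big1 // => i _.
rewrite coefZ coefXn; case: eqP => [E|_]; last by rewrite mulr0.
by rewrite FN ?mul0r // -E.
Qed.

Lemma wlead_coefM M N F G : wle M F -> wle N G ->
  (wlead (F * G))`_(M + N) = (wlead F)`_M * (wlead G)`_N.
Proof. by move=> FM GN; rewrite wleadM coefM_top ?size_wlead. Qed.

Lemma wlead_coefX N F n : wle N F -> (wlead (F ^+ n))`_(n * N) = (wlead F)`_N ^+ n.
Proof.
move=> FN; elim: n => [|n IH].
  by rewrite mul0n !expr0 wlead1 coef1.
by rewrite !exprS mulSn wlead_coefM ?IH //; exact: wleXn.
Qed.

Hypothesis p_gt0 : (0 < p)%N.

Lemma wlead_coef_reduced F i j : (size F <= p)%N -> (j < p)%N ->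
  (wlead F)`_(p * i + p.+1 * j) = F`_j`_i.
Proof.
move=> sF jp; rewrite wleadE coef_sum.
have inj (i1 i2 j1 j2 : nat) : (j1 < p)%N -> (j2 < p)%N ->
    (p * i1 + p.+1 * j1 = p * i2 + p.+1 * j2)%N -> i1 = i2 /\ j1 = j2.
  move=> h1 h2 E.
  have E' : ((i1 + j1) * p + j1 = (i2 + j2) * p + j2)%N by nia.
  have := congr1 (fun n => (n %% p)%N) E'; rewrite !modnMDl !modn_small // => jE.
  by split => //; subst j2; nia.
have [jF|jF] := leqP (size F) j.
  rewrite [F`_j]nth_default // coef0 big1 // => j' _; rewrite coef_sum big1 // => i' _.
  rewrite coefZ coefXn; case: eqP => [E|]; last by rewrite mulr0.
  have [|_ jE] := inj _ _ _ _ jp _ E; first exact: leq_trans (ltn_ord _) sF.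
  by suff : (j < size F)%N; [rewrite ltnNge jF | rewrite {1}jE].
rewrite (bigD1 (Ordinal jF)) //= [X in _ + X]big1 ?addr0; last first.
  move=> j'; rewrite -val_eqE /= => jj'; rewrite coef_sum big1 // => i' _.
  rewrite coefZ coefXn; case: eqP => [E|]; last by rewrite mulr0.
  have [|_ jE] := inj _ _ _ _ jp _ E; first exact: leq_trans (ltn_ord _) sF.
  by case/eqP: jj'; exact: esym.
rewrite coef_sum.
have [iF|iF] := leqP (size F`_j) i.
  rewrite [RHS]nth_default // big1 // => i' _.
  rewrite coefZ coefXn; case: eqP => [E|]; last by rewrite mulr0.
  have [iE _] := inj _ _ _ _ jp jp E.
  by suff : (i < size (F`_j)%R)%N; [rewrite ltnNge iF | rewrite {1}iE].
rewrite (bigD1 (Ordinal iF)) //= big1 ?addr0; last first.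
  move=> i'; rewrite -val_eqE /= => ii'.
  rewrite coefZ coefXn; case: eqP => [E|]; last by rewrite mulr0.
  have [iE _] := inj _ _ _ _ jp jp E.
  by case/eqP: ii'; exact: esym.
by rewrite coefZ coefXn eqxx mulr1.
Qed.

Section Reduction.
Variable h : {poly {poly L}}.
Hypotheses (h_monic : h \is monic) (size_h : size h = p.+1).
Hypotheses (wle_h : wle (p.+1 * p) h) (wlead_h : (wlead h)`_(p.+1 * p) = 0).

(** The hypothesis [wlead_h] says that the leading form of [h] dies under the substitution, so a
    division step, which subtracts a multiple [m * h], leaves the coefficient of weight [N]
    unchanged. *)
Lemma wle_rmodp N F : wle N F ->
  wle N (rmodp F h) /\ (wlead (rmodp F h))`_N = (wlead F)`_N.
Proof.
have [n] := ubnP (size F); elim: n F => // n IH F sF FN.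
have [s_le|s_gt] := leqP (size F) p.
  by rewrite rmodp_small // size_h ltnS.
pose d := (size F).-1; pose c := lead_coef F.
have dE : size F = d.+1 by rewrite /d prednK // (leq_trans _ s_gt).
have pd : (p <= d)%N by rewrite -ltnS -dE.
pose m := c%:P * 'X^(d - p).
have c0 : c != 0 by rewrite lead_coef_eq0 -size_poly_eq0 dE.
(* A nonzero coefficient of degree [d >= p] in [z] forces [N >= p.+1 * p], so the weight [M] left
   for the multiplier [m] is a true difference. *)
have [M NE] : exists M, N = (M + p.+1 * p)%N.
  exists (N - p.+1 * p)%N; rewrite subnK //.
  have : ~~ (N < p * 0 + p.+1 * d)%N || ~~ (N < p * (size c).-1 + p.+1 * d)%N.
    apply/orP; right; apply/negP => /(wle_coef FN) /eqP.
    have -> : F`_d = c by rewrite /c lead_coefE.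
    by rewrite -lead_coefE lead_coef_eq0 (negbTE c0).
  by rewrite -!leqNgt; nia.
have mM : wle M m.
  split=> i j hij; rewrite coefCM coefXn; case: eqP => [jE|_]; last by rewrite mulr0 coef0.
  rewrite mulr1 /c lead_coefE (wle_coef FN) // -/d.
  rewrite NE; nia.
have mhN : wle N (m * h) by rewrite NE; exact: wleM.
have s1 : (size (F - m * h)%R < n)%N.
  rewrite -ltnS; apply: leq_trans sF; rewrite ltnS dE ltnS.
  apply/leq_sizeP => k dk; rewrite coefB /m -mulrA coefCM mulrC coefXnM mulrC.
  rewrite ltnNge (leq_trans (leq_subr _ _) dk) /=.
  move: dk; rewrite leq_eqVlt => /orP[/eqP <-|dk].
    rewrite subKn // -[h`_p]/(h`_(p.+1.-1)) -size_h -lead_coefE (monicP h_monic).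
    by rewrite mulr1 /c lead_coefE subrr.
  by rewrite !nth_default ?mulr0 ?subrr // ?dE // size_h; lia.
have [H1 H2] := IH _ s1 (wleB FN mhN).
have E : rmodp (F - m * h) h = rmodp F h.
  by rewrite rmodpB // rmodp_mull // subr0.
rewrite E in H1 H2; split=> //; rewrite H2 wleadB coefB NE wlead_coefM //.
by rewrite wlead_h mulr0 subr0.
Qed.

End Reduction.
End Weight.

(** * Bombieri's bound for the number of points *)

Section Bombieri.
Import Pdiv.Ring Pdiv.RingMonic.
Variables (L : finFieldType) (p : nat).
Hypothesis p_gt0 : (0 < p)%N.
Implicit Types F G : {poly {poly L}}.
Local Notation wle := (@wle L p).
Local Notation wlead := (@wlead L p).

(* The monomial of weight [d] and degree less than [p] in [z]; for [d < p * p]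
   the subtraction may be truncated. *)
Definition wmon (d : nat) : {poly {poly L}} := ('X^(d %/ p - d %% p))%:P * 'X^(d %% p).

Lemma wmon_weight d : (p * p <= d)%N ->
  (p * (d %/ p - d %% p) + p.+1 * (d %% p))%N = d.
Proof.
move=> pd; have lt := ltn_pmod d p_gt0.
have : (p <= d %/ p)%N by rewrite leq_divRL.
by move=> ?; rewrite [RHS](divn_eq d p); nia.
Qed.

Lemma wle_wmon d : (p * p <= d)%N -> wle d (wmon d).
Proof.
move=> /wmon_weight E; rewrite -{1}E /wmon.
by have := @wle_monom L p (d %/ p - d %% p) (d %% p) 1; rewrite scale1r.
Qed.

Lemma wlead_wmon d : (p * p <= d)%N -> wlead (wmon d) = 'X^d.
Proof.
move=> /wmon_weight E; rewrite /wmon /wlead rmorphM /= map_polyC /= map_polyXn.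
by rewrite hornerM hornerC hornerXn comp_Xn_poly -!exprM -exprD E.
Qed.

Lemma wle_cst N (c : L) : wle N c%:P%:P.
Proof.
apply: (@wleW _ _ 0) => //; have := @wle_monom L p 0 0 c.
by rewrite !expr0 alg_polyC mulr1 !muln0.
Qed.

(** Starting at [p * p] avoids the gaps of the semigroup generated by [p] and [p.+1]: from there on
    every weight is attained, and [wlead] reads off the coefficients. *)
Definition wspan k (f : {ffun 'I_k -> L}) : {poly {poly L}} :=
  \sum_(i < k) (f i)%:P%:P * wmon (p * p + i).

Lemma wspanB k (f g : {ffun 'I_k -> L}) : wspan (f - g) = wspan f - wspan g.
Proof.
rewrite /wspan -sumrB; apply: eq_bigr => i _.
by rewrite !ffunE !polyCB mulrBl.
Qed.

Lemma wle_wspan_term k (f : {ffun 'I_k -> L}) (i : 'I_k) :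
  wle (p * p + i) ((f i)%:P%:P * wmon (p * p + i)).
Proof.
rewrite -[X in wle X _]add0n; apply: wleM; first exact: wle_cst.
by apply: wle_wmon; exact: leq_addr.
Qed.

Lemma wle_wspan k (f : {ffun 'I_k -> L}) : wle (p * p + k.-1) (wspan f).
Proof.
apply: wle_sum => i _; apply: (wleW _ (wle_wspan_term f i)).
by rewrite leq_add2l -ltnS (leq_trans (ltn_ord i)) // leqSpred.
Qed.

Lemma wlead_wspan k (f : {ffun 'I_k -> L}) (i : 'I_k) :
  (wlead (wspan f))`_(p * p + i) = f i.
Proof.
rewrite wlead_sum coef_sum (bigD1 i) //= big1 ?addr0 => [|j ji].
  by rewrite wleadM wlead_wmon ?leq_addr // /wlead map_polyC hornerC /=
    comp_polyC coefCM coefXn eqxx mulr1.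
rewrite wleadM wlead_wmon ?leq_addr // /wlead map_polyC hornerC /= comp_polyC.
by rewrite coefCM coefXn eqn_add2l val_eqE eq_sym (negbTE ji) mulr0.
Qed.

Lemma wspan_exact k (f : {ffun 'I_k -> L}) : f != 0 ->
  exists2 d, (p * p <= d < p * p + k)%N & wle d (wspan f) /\ (wlead (wspan f))`_d != 0.
Proof.
move=> f0; have [i0 fi0] : exists i, f i != 0.
  apply/existsP; rewrite -negb_forall; apply: contra f0 => /forallP f0.
  by apply/eqP/ffunP => i; rewrite ffunE; apply/eqP.
case: (@arg_maxnP _ i0 (fun i => f i != 0) val fi0) => i fi imax.
exists (p * p + i)%N; first by rewrite leq_addr ltn_add2l ltn_ord.
rewrite wlead_wspan; split=> //; apply: wle_sum => j _.
have [fj|/imax] := eqVneq (f j) 0; first by rewrite fj mul0r; exact: wle0.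
by move=> ji; apply: (wleW _ (wle_wspan_term f j)); rewrite leq_add2l.
Qed.

Definition wcoefs N F : {ffun 'I_N.+1 -> L} := [ffun d => (wlead F)`_(val d)].

Lemma wcoefs_inj N F : (size F <= p)%N -> wle N F -> wcoefs N F = 0 -> F = 0.
Proof.
move=> sF FN /ffunP E; apply/polyP => j; apply/polyP => i; rewrite !coef0.
have [jp|jp] := ltnP j p; last by rewrite [F`_j]nth_default ?coef0 // (leq_trans sF).
have [h|h] := leqP (p * i + p.+1 * j) N; last exact: (wle_coef FN).
have := E (Ordinal (h : (_ < N.+1)%N)); rewrite !ffunE /=.
by rewrite wlead_coef_reduced.
Qed.

Lemma wcoefsB N F G : wcoefs N (F - G) = wcoefs N F - wcoefs N G.
Proof. by apply/ffunP => i; rewrite !ffunE wleadB coefB. Qed.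

Variable h : {poly {poly L}}.
Hypotheses (h_monic : h \is monic) (size_h : size h = p.+1).
Hypotheses (wle_h : wle (p.+1 * p) h) (wlead_h : (wlead h)`_(p.+1 * p) = 0).

Lemma size_rmodp_h F : (size (rmodp F h) <= p)%N.
Proof. by rewrite -ltnS -size_h ltn_rmodpN0 // monic_neq0. Qed.

(** Pigeonhole: a remainder modulo [h] of weight at most [N] is determined by [N.+1] coefficients of
    its [wlead], which plays the part of an upper bound for a dimension. *)
Lemma collision N (A : finType) (T : A -> {poly {poly L}}) :
  (forall f, wle N (T f)) -> (#|L| ^ N.+1 < #|A|)%N ->
  exists f g, f != g /\ rmodp (T f - T g) h = 0.
Proof.
move=> TN card.
have /injectivePn[f [g fg E]] : ~~ injectiveb (fun f => wcoefs N (rmodp (T f) h)).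
  apply: contraL card => /injectiveP /leq_card.
  by rewrite card_ffun card_ord -leqNgt.
exists f, g; split=> //.
apply: (@wcoefs_inj N); first exact: size_rmodp_h.
  by have [] := wle_rmodp p_gt0 h_monic size_h wle_h wlead_h (wleB (TN f) (TN g)).
by rewrite rmodpB // wcoefsB E subrr.
Qed.

Definition eval2 (P : L * L) F : L := F.[P.2%:P].[P.1].

Lemma eval2M P F G : eval2 P (F * G) = eval2 P F * eval2 P G.
Proof. by rewrite /eval2 !hornerM. Qed.
Lemma eval2D P F G : eval2 P (F + G) = eval2 P F + eval2 P G.
Proof. by rewrite /eval2 !hornerD. Qed.
Lemma eval2X P F n : eval2 P (F ^+ n) = eval2 P F ^+ n.
Proof. by rewrite /eval2 !horner_exp. Qed.
Lemma eval2_sum P I (r : seq I) (Q : pred I) (E : I -> {poly {poly L}}) :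
  eval2 P (\sum_(i <- r | Q i) E i) = \sum_(i <- r | Q i) eval2 P (E i).
Proof. by rewrite /eval2 !horner_sum. Qed.
Lemma eval2_cst P c : eval2 P c%:P%:P = c.
Proof. by rewrite /eval2 !hornerC. Qed.
Lemma eval2_rmodp P F : eval2 P h = 0 -> eval2 P (rmodp F h) = eval2 P F.
Proof.
by move=> hP; rewrite [in RHS](rdivp_eq h_monic F) eval2D eval2M hP mulr0 add0r.
Qed.

(** By Fermat's little theorem in [L], this is the indicator of [P] as a function on [L * L]; it has
    a weight bound independent of [P]. *)
Definition dirac (P : L * L) : {poly {poly L}} :=
  (1 - ('X - P.1%:P)%:P ^+ #|L|.-1) * (1 - ('X - P.2%:P%:P) ^+ #|L|.-1).

Lemma dirac_eq (c x : L) : 1 - (x - c) ^+ #|L|.-1 = (x == c)%:R.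
Proof.
have card_gt1 := finNzRing_gt1 L.
have [->|xc] := eqVneq x c.
  by rewrite subrr expr0n; case: #|L| card_gt1 => [|[|n]] //; rewrite subr0.
have x0 : x - c != 0 by rewrite subr_eq0.
apply/eqP; rewrite subr_eq0; apply/eqP/(mulfI x0).
by rewrite mulr1 -exprS prednK ?expf_card // ltnW.
Qed.

Lemma eval2_dirac P Q : eval2 Q (dirac P) = (Q == P)%:R.
Proof.
rewrite /eval2 /dirac !(hornerM, hornerD, hornerN, hornerC, horner_exp, hornerX).
rewrite !dirac_eq.
by case: Q P => [a b] [c d]; rewrite xpair_eqE /= -natrM mulnb.
Qed.

Lemma wle_dirac P : wle (#|L|.-1 * p + #|L|.-1 * p.+1) (dirac P).
Proof.
apply: wleM; apply: wleB; try exact: (wle_cst _ 1); apply: wleXn.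
  rewrite polyCB; apply: wleB; last exact: wle_cst.
  by have := @wle_monom L p 1 0 1; rewrite scale1r expr0 mulr1 expr1 muln0 muln1 addn0.
apply: wleB; last exact: wle_cst.
by have := @wle_monom L p 0 1 1; rewrite scale1r expr0 polyC1 mul1r expr1 muln0 muln1.
Qed.

(* [h, t |-> G h + (a polynomial interpolating t on Z)] is injective modulo the
   curve, so the zeros of [G] number at most its weight, up to the gaps of the
   weight semigroup. *)
Lemma zeros_bound G D (Z : {set L * L}) : wle D G -> (wlead G)`_D != 0 ->
  (forall P, P \in Z -> eval2 P h = 0 /\ eval2 P G = 0) -> (#|Z| <= D + p * p)%N.
Proof.
move=> GD G0 ZP; rewrite leqNgt; apply/negP => big.
(* [N] bounds the weight of every [T ft], and [k = N0.+1] makes the source larger than the target: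
   [k + #|Z| > N.+1] because [#|Z| > D + p * p]. *)
pose N0 := (#|L|.-1 * p + #|L|.-1 * p.+1)%N.
pose N := (N0 + D + p * p)%N; pose k := N0.+1.
pose T (ft : {ffun 'I_k -> L} * {ffun 'I_#|Z| -> L}) : {poly {poly L}} :=
  G * wspan ft.1 + \sum_i (ft.2 i)%:P%:P * dirac (enum_val i).
have evT f t j : eval2 (enum_val j) (T (f, t)) = t j.
  have [_ GP] := ZP _ (enum_valP j).
  rewrite eval2D eval2M GP mul0r add0r eval2_sum (bigD1 j) //= big1 ?addr0 => [|i ij].
    by rewrite eval2M eval2_cst eval2_dirac eqxx mulr1.
  rewrite eval2M eval2_dirac (inj_eq enum_val_inj) eq_sym (negbTE ij) mulr0 //.
have TB f t f' t' : T (f, t) - T (f', t') = T (f - f', t - t').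
  rewrite /T /= wspanB mulrBr opprD addrACA; congr (_ + _).
  by rewrite -sumrB; apply: eq_bigr => i _; rewrite !ffunE !polyCB mulrBl.
have [||[f1 t1] [[f2 t2] [ft0]]] := @collision N _ T.
- move=> [f t]; apply: wleD.
    apply: (wleW _ (wleM GD (wle_wspan f))); rewrite /N /k; lia.
  apply: wle_sum => i _; apply: (@wleW _ _ (0 + N0)); first by rewrite /N; lia.
  by apply: wleM; [exact: wle_cst | exact: wle_dirac].
- rewrite card_prod !card_ffun !card_ord -expnD ltn_exp2l ?finNzRing_gt1 //.
  by rewrite /N /k; lia.
rewrite TB; set f := f1 - f2; set t := t1 - t2 => E.
have t0 : t = 0.
  apply/ffunP => j; rewrite [RHS]ffunE -(evT f t j).
  have [hP _] := ZP _ (enum_valP j).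
  by rewrite -eval2_rmodp // E /eval2 !horner0.
have f0 : f != 0.
  rewrite subr_eq0; apply: contraNneq ft0 => ->.
  by move/eqP: t0; rewrite subr_eq0 => /eqP ->.
have [d _ [fd fd0]] := wspan_exact f0.
have Tf : T (f, t) = G * wspan f.
  rewrite /T t0 big1 ?addr0 // => i _; by rewrite ffunE !polyC0 mul0r.
(* The product [G * wspan f] has a nonzero coefficient at weight [D + d], which division by [h]
   preserves, yet its remainder is zero. *)
have := wleM GD fd; rewrite -Tf => Td.
have [_] := wle_rmodp p_gt0 h_monic size_h wle_h wlead_h Td.
rewrite E Tf wlead_coefM // /wlead rmorph0 horner0 coef0 => /esym/eqP.
by rewrite mulf_eq0 (negbTE G0) (negbTE fd0).
Qed.

(* Pigeonhole gives [f_j], not all zero, of weight less than [Q] with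
   [\sum_j f_j ^+ Q * e_j = 0] on the curve, where [e_j] is the monomial of
   weight [j].  Then [G := \sum_j f_j * e_j ^+ Q] is nonzero, as its terms have
   distinct weights, and [G ^+ Q] vanishes at the [L]-points since there
   [e_j ^+ (Q ^ 2) = e_j]. *)
Lemma curve_points (Q : nat) : (p ^ 4 + 3 * p ^ 2 + 1 < Q)%N ->
  #|L| = (Q ^ 2)%N -> [pchar L].-nat Q ->
  (#|[set P : L * L | (eval2 P h == 0)%R]| <= Q ^ 2 + (2 * p ^ 2 + 1) * Q + p ^ 2)%N.
Proof.
move=> Qbig cardL charQ.
(* With [k = Q - p ^ 2] the weights of the [wspan (f j)] stay below [Q], so the terms of [G] have
   distinct weights. With [m = Q + p ^ 2 + 1] the pigeonhole condition [N.+1 < k * m] amounts to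
   [p ^ 4 + 3 * p ^ 2 + 1 < Q]. *)
pose k := (Q - p ^ 2)%N; pose m := (Q + p ^ 2 + 1)%N.
have kE : (k + p ^ 2 = Q)%N by rewrite subnK //; nia.
have k_gt0 : (0 < k)%N by nia.
have charP : [pchar {poly {poly L}}].-nat Q.
  by apply: sub_in_pnat charQ => c _; rewrite !pchar_poly.
pose T (f : {ffun 'I_m -> {ffun 'I_k -> L}}) : {poly {poly L}} :=
  \sum_j wspan (f j) ^+ Q * wmon (p * p + j).
pose N := (Q * (p * p + k.-1) + (p * p + m.-1))%N.
(* Raising to the power [Q] is additive here, so a collision of [T] gives a nonzero [f] with
   [T f = 0] on the curve. *)
have TB f g : T f - T g = T (f - g).
  rewrite /T -sumrB; apply: eq_bigr => j _.
  by rewrite !ffunE wspanB exprDn_pchar // exprNn_pchar // mulrBl.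
have [||f1 [f2 [f0]]] := @collision N _ T.
- move=> f; apply: wle_sum => j _.
  apply: (@wleW _ _ (Q * (p * p + k.-1) + (p * p + j))).
    by rewrite leq_add2l leq_add2l -ltnS prednK ?ltn_ord // /m addn1.
  by apply: wleM; [apply: wleXn; exact: wle_wspan | apply: wle_wmon; rewrite leq_addr].
- rewrite !card_ffun !card_ord -expnM ltn_exp2l ?finNzRing_gt1 //.
  by rewrite /N /m; nia.
rewrite -subr_eq0 in f0; rewrite TB; set f := f1 - f2 in f0 * => E.
have [j0 fj0] : exists j, f j != 0.
  apply/existsP; rewrite -negb_forall; apply: contra f0 => /forallP f0.
  by apply/eqP/ffunP => i; rewrite [RHS]ffunE; apply/eqP.
case: (@arg_maxnP _ j0 (fun j => f j != 0) val fj0) => j fj jmax.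
have [d /andP[d_ge d_lt] [fd fd0]] := wspan_exact fj.
pose G := \sum_j wspan (f j) * wmon (p * p + j) ^+ Q.
pose D := (d + Q * (p * p + j))%N.
have wj : wle D (wspan (f j) * wmon (p * p + j) ^+ Q).
  by apply: wleM => //; apply: wleXn; apply: wle_wmon; rewrite leq_addr.
have rest : wle D.-1 (\sum_(i < m | i != j) wspan (f i) * wmon (p * p + i) ^+ Q).
  apply: wle_sum => i ij.
  have [->|/jmax] := eqVneq (f i) 0.
    rewrite [wspan _]big1 ?mul0r => [|? _]; first exact: wle0.
    by rewrite ffunE !polyC0 mul0r.
  move=> /= i_le; have {ij i_le} ij : (i < j)%N by rewrite ltn_neqAle i_le andbT.
  apply: (@wleW _ _ ((p * p + k.-1) + Q * (p * p + i))); last first.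
    apply: wleM; first exact: wle_wspan.
    by apply: wleXn; apply: wle_wmon; rewrite leq_addr.
  by rewrite /D; nia.
have GE : G = wspan (f j) * wmon (p * p + j) ^+ Q
           + \sum_(i < m | i != j) wspan (f i) * wmon (p * p + i) ^+ Q.
  by rewrite /G (bigD1 j).
have D_gt0 : (0 < D)%N by rewrite /D; nia.
have GD : wle D G by rewrite GE; apply: wleD => //; apply: (wleW _ rest); exact: leq_pred.
have G0 : (wlead G)`_D != 0.
  have -> : wlead G = wlead (wspan (f j) * wmon (p * p + j) ^+ Q)
     - wlead (- \sum_(i < m | i != j) wspan (f i) * wmon (p * p + i) ^+ Q).
    by rewrite -wleadB opprK -GE.
  rewrite coefB [X in _ - X]nth_default ?subr0; last first.
    by have := size_wlead (wleN rest); rewrite prednK.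
  rewrite /D wlead_coefM //; last by apply: wleXn; apply: wle_wmon; rewrite leq_addr.
  rewrite mulf_neq0 // wlead_coefX; last by apply: wle_wmon; rewrite leq_addr.
  by rewrite wlead_wmon ?leq_addr // coefXn eqxx expr1n oner_neq0.
apply: leq_trans (zeros_bound GD G0 _) _; last first.
  by have := ltn_ord j; rewrite /D /m; nia.
move=> P; rewrite inE => /eqP hP; split=> //.
have expQ (x : L) : x ^+ Q ^+ Q = x by rewrite -exprM -[(Q * Q)%N]/(Q ^ 2)%N -cardL expf_card.
have Q0 : (0 < Q)%N by nia.
suff : eval2 P G ^+ Q == 0 by rewrite expf_eq0 Q0 => /eqP.
apply/eqP.
have charL : [pchar L].-nat Q by [].
have powD : {morph (fun x : L => x ^+ Q) : x y / x + y}.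
  by move=> x y; rewrite exprDn_pchar.
have pow0 : (0 : L) ^+ Q = 0 by rewrite expr0n; case: (Q) Q0.
rewrite eval2_sum (big_morph _ powD pow0).
transitivity (eval2 P (T f)); last by rewrite -eval2_rmodp // E /eval2 !horner0.
rewrite eval2_sum; apply: eq_bigr => i _; rewrite (eval2M P (wspan _ ^+ Q)) (eval2M P (wspan _)).
by rewrite !(eval2X P _ Q) exprMn expQ.
Qed.
End Bombieri.

(** * The trace of a finite field *)

Lemma roots_card_le (L : finFieldType) (f : {poly L}) (A : {set L}) :
  f != 0 -> (forall x, x \in A -> root f x) -> (#|A| < size f)%N.
Proof.
move=> f0 Af; rewrite cardE; apply: max_poly_roots; rewrite ?enum_uniq //.
by apply/allP => x; rewrite mem_enum; apply: Af.
Qed.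

Section Trace.
Variables (p n : nat) (L : finFieldType) (iota : {rmorphism 'F_p -> L}).
Hypotheses (p_pr : prime p) (n_gt0 : (0 < n)%N) (cardL : #|L| = (p ^ n)%N).

Lemma pcharL : p \in [pchar L].
Proof.
have := pchar_Fp p_pr; rewrite !inE p_pr /= => /eqP E.
by rewrite -(rmorph_nat iota) E rmorph0.
Qed.

Lemma pchar_nat i : [pchar L].-nat (p ^ i)%N.
Proof. by rewrite pnatX pnatE // pcharL. Qed.

Lemma frobD i (x y : L) : (x + y) ^+ (p ^ i) = x ^+ (p ^ i) + y ^+ (p ^ i).
Proof. exact: exprDn_pchar (pchar_nat i). Qed.

Lemma frobN i (x : L) : (- x) ^+ (p ^ i) = - x ^+ (p ^ i).
Proof. exact: exprNn_pchar (pchar_nat i). Qed.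

Lemma Fp_expp (k : 'F_p) : k ^+ p = k.
Proof. by rewrite -{2}[k]expf_card card_Fp. Qed.

(** Otherwise [x] and the [p] elements of the image would be [p.+1] roots of ['X^p - 'X]. *)
Lemma frob_fix (x : L) : x ^+ p = x -> exists k, iota k = x.
Proof.
move=> xp; pose A := x |: [set iota k | k : 'F_p].
have [/imsetP[k _ ->]|xA] := boolP (x \in [set iota k | k : 'F_p]); first by exists k.
have szf : size ('X^p - 'X : {poly L}) = p.+1.
  by rewrite size_polyDl ?size_polyXn // size_polyN size_polyX ltnS prime_gt1.
have := @roots_card_le L ('X^p - 'X) A; rewrite szf.
rewrite /A cardsU1 xA card_imset ?card_Fp //; last exact: fmorph_inj.
rewrite add1n ltnn => H; suff : false by []. apply: H => [|y].
  by rewrite -size_poly_eq0 szf.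
rewrite rootE !hornerE !inE => /orP[/eqP->|/imsetP[k _ ->]].
  by rewrite xp subrr.
by rewrite -rmorphXn Fp_expp subrr.
Qed.

Definition Trace (x : L) : L := \sum_(i < n) x ^+ (p ^ i).

Lemma TraceD x y : Trace (x + y) = Trace x + Trace y.
Proof. by rewrite -big_split /=; apply: eq_bigr => i _; rewrite frobD. Qed.

Lemma TraceN x : Trace (- x) = - Trace x.
Proof. by rewrite -sumrN; apply: eq_bigr => i _; rewrite frobN. Qed.

Lemma Trace_frob x : Trace (x ^+ p) = Trace x.
Proof.
rewrite /Trace; case: n n_gt0 cardL => // m _ cL.
rewrite big_ord_recr big_ord_recl /= -exprM -expnS -cL expf_card addrC.
by rewrite expn0 expr1; congr (_ + _); apply: eq_bigr => i _; rewrite -exprM -expnS.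
Qed.

Lemma Trace_fix x : Trace x ^+ p = Trace x.
Proof.
have powD : {morph (fun x : L => x ^+ p) : x y / x + y}.
  by move=> a b; have := frobD 1 a b; rewrite expn1.
have pow0 : (0 : L) ^+ p = 0 by rewrite expr0n; case: (p) p_pr.
rewrite -{2}Trace_frob /Trace (big_morph _ powD pow0).
by apply: eq_bigr => i _; rewrite -!exprM mulnC.
Qed.

Lemma tr_subproof x : exists k, iota k == Trace x.
Proof. by have [k <-] := frob_fix (Trace_fix x); exists k. Qed.

Definition tr x : 'F_p := xchoose (tr_subproof x).

Lemma trE x : iota (tr x) = Trace x.
Proof. exact/eqP/(xchooseP (tr_subproof x)). Qed.

Lemma trD x y : tr (x + y) = tr x + tr y.
Proof. by apply: (fmorph_inj iota); rewrite rmorphD !trE TraceD. Qed.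

Lemma trN x : tr (- x) = - tr x.
Proof. by apply: (fmorph_inj iota); rewrite rmorphN !trE TraceN. Qed.

Lemma tr_eq0 u : tr u = 0 -> exists y, y ^+ p - y = u.
Proof.
move=> tru; pose f (y : L) := y ^+ p - y; pose A := [set f y | y : L].
pose B := [set u | tr u == 0].
have p0 := prime_gt0 p_pr; have p1 := prime_gt1 p_pr.
have AB : A \subset B.
  by apply/subsetP => _ /imsetP[y _ ->]; rewrite inE -(fmorph_eq0 iota) trE
    TraceD TraceN Trace_frob subrr.
have cB : (#|B| <= p ^ n.-1)%N.
  pose g : {poly L} := \sum_(i < n) 'X^(p ^ i).
  have gE : g = 'X^(p ^ n.-1) + \sum_(i < n.-1) 'X^(p ^ i).
    by rewrite /g; case: n n_gt0 => // m _; rewrite big_ord_recr addrC.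
  have szg : size g = (p ^ n.-1).+1.
    rewrite gE size_polyDl size_polyXn // ltnS.
    apply: leq_trans (size_sum _ _ _) _; apply/bigmax_leqP => i _.
    by rewrite size_polyXn ltn_exp2l.
  rewrite -ltnS -szg; apply: roots_card_le; first by rewrite -size_poly_eq0 szg.
  move=> x; rewrite inE -(fmorph_eq0 iota) trE => /eqP trx0.
  rewrite rootE horner_sum; apply/eqP; rewrite -[RHS]trx0.
  by apply: eq_bigr => i _; rewrite hornerXn.
have cA : (p ^ n <= #|A| * p)%N.
  rewrite -sum_nat_const -cardL -[X in (X <= _)%N]sum1_card (partition_big f (mem A)) /=; last first.
    by move=> y _; exact: imset_f.
  apply: leq_sum => _ /imsetP[z _ ->]; rewrite sum1_card.
  have szf : size ('X^p - 'X - (f z)%:P : {poly L}) = p.+1.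
    by rewrite -addrA size_polyDl ?size_polyXn // -opprD size_polyN
      (leq_ltn_trans (size_polyD _ _)) // size_polyX size_polyC gtn_max ltnS p1
      (leq_ltn_trans (leq_b1 _)).
  rewrite -ltnS -szf -(cardsE (fun y => f y == f z)).
  apply: roots_card_le; first by rewrite -size_poly_eq0 szf.
  by move=> x; rewrite inE rootE !hornerE -/(f x) subr_eq0.
have /eqP AeqB : A == B.
  rewrite eqEcard AB (leq_trans cB) // -(leq_pmul2r p0) -expnSr prednK //.
have : u \in B by rewrite inE tru.
by rewrite -AeqB => /imsetP[y _ ->]; exists y.
Qed.

End Trace.

(** * Kloosterman sums over extension fields *)

Section Curve.
Variables (L : finFieldType) (p : nat) (a b : L).
Hypothesis p_gt1 : (1 < p)%N.

(* [y ^+ p - y = x + a / x - b] in the coordinates [x] and [z = x * y]. *)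
Definition curve : {poly {poly L}} :=
  'X^p - (('X^(p.-1))%:P * 'X + ('X^(p.+1) - b *: 'X^p + a *: 'X^(p.-1))%:P).

Let rest_size : (size (('X^(p.-1))%:P * 'X + ('X^(p.+1) - b *: 'X^p + a *: 'X^(p.-1))%:P
   : {poly {poly L}})%R <= p)%N.
Proof.
apply: leq_trans (size_polyD _ _) _; rewrite geq_max; apply/andP; split.
  rewrite mul_polyC; apply: leq_trans (size_scale_leq _ _) _.
  by rewrite size_polyX.
by rewrite (leq_trans (size_polyC_leq1 _)) // ltnW.
Qed.

Lemma size_curve : size curve = p.+1.
Proof. by rewrite size_polyDl size_polyXn // size_polyN ltnS. Qed.

Lemma curve_monic : curve \is monic.
Proof.
by rewrite monicE lead_coefDl ?lead_coefXn // size_polyXn size_polyN ltnS.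
Qed.

Lemma wle_curve : wle p (p.+1 * p) curve.
Proof.
have mono i j c : (p * i + p.+1 * j <= p.+1 * p)%N ->
    wle p (p.+1 * p) ((c *: 'X^i)%:P * 'X^j : {poly {poly L}}).
  by move=> h; apply: (wleW h); exact: wle_monom.
have := mono 0 p 1; rewrite scale1r mul1r => m1.
have := mono p.-1 1%N 1; rewrite scale1r expr1 => m2.
have := mono p.+1 0 1; rewrite scale1r mulr1 => m3.
have := mono p 0 b; rewrite mulr1 => m4.
have := mono p.-1 0 a; rewrite mulr1 => m5.
rewrite /curve; apply: wleB; first by apply: m1; lia.
apply: wleD; first by apply: m2; nia.
rewrite polyCD polyCB; apply: wleD; last by apply: m5; nia.
by apply: wleB; [apply: m3 | apply: m4]; nia.
Qed.

(** Only [z ^+ p] and [x ^+ p.+1] have the top weight, and the substitution makes them cancel. *)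
Lemma wlead_curve : (wlead p curve)`_(p.+1 * p) = 0.
Proof.
rewrite /curve wleadB /wlead rmorphD rmorphM /= !map_polyC !map_polyXn map_polyX /=.
rewrite hornerD hornerM !hornerC hornerX hornerXn.
rewrite comp_polyD comp_polyB !comp_polyZ !comp_Xn_poly -!exprM -exprD.
rewrite !(coefB, coefD, coefZ, coefXn).
have e1 : (p.+1 * p == p * p.-1 + p.+1)%N = false by apply/negbTE/eqP; nia.
have e2 : (p.+1 * p == p * p.+1)%N by rewrite mulnC.
have e3 : (p.+1 * p == p * p)%N = false by apply/negbTE/eqP; nia.
have e4 : (p.+1 * p == p * p.-1)%N = false by apply/negbTE/eqP; nia.
by rewrite eqxx e1 e2 e3 e4 !mulr0 subr0 addr0 add0r subrr.
Qed.

Lemma eval2_curve x y : x != 0 -> y ^+ p - y = x + a / x - b ->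
  eval2 (x, x * y) curve = 0.
Proof.
move=> x0 E; rewrite /eval2 /curve !(hornerD, hornerN, hornerM, hornerC, horner_exp, hornerX, hornerZ) /=.
have -> : (x * y) ^+ p = x ^+ p * (y + x + a / x - b).
  by rewrite exprMn; congr (_ * _); rewrite -addrA -addrA [x + _]addrA -E addrC subrK.
case: p p_gt1 => // q _; rewrite /= !exprS; field.
exact: x0.
Qed.
End Curve.

Section SumBound.
Variables (p mu : nat) (L : finFieldType) (iota : {rmorphism 'F_p -> L}).
Hypothesis p_pr : prime p.
Let Q := (p ^ mu)%N.
Let n := (2 * mu)%N.
Hypothesis n_gt0 : (0 < n)%N.
Hypothesis cardL : #|L| = (p ^ n)%N.
Hypothesis Qbig : (p ^ 4 + 3 * p ^ 2 + 1 < Q)%N.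
Local Notation tr := (tr iota p_pr n_gt0 cardL).
Variable a : 'F_p.

Definition trace_fiber (b : 'F_p) := [set x : L | (x != 0) && (tr (x + iota a / x) == b)].

Lemma trace_fiber_bound b : (p * #|trace_fiber b| <= Q ^ 2 + (2 * p ^ 2 + 1) * Q + p ^ 2)%N.
Proof.
have p0 := prime_gt0 p_pr; have p1 := prime_gt1 p_pr.
have [->|[x0]] := set_0Vmem (trace_fiber b); first by rewrite cards0 muln0.
(* [beta] is the value of [x + a / x] at one point of the fibre, so that [x + a / x - beta] has
   trace zero on the whole fibre. Each [x] there yields [p] points of the curve, since [y] may be
   shifted by the prime field. *)
rewrite inE => /andP[_ /eqP trx0]; pose beta := x0 + iota a / x0.
have cardQ : #|L| = (Q ^ 2)%N by rewrite cardL -expnM mulnC.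
have charQ : [pchar L].-nat Q by apply: (pchar_nat iota).
have := curve_points p0 (curve_monic (iota a) beta p1) (size_curve _ _ p1)
  (wle_curve (iota a) beta p1) (wlead_curve _ _ p1) Qbig cardQ charQ.
apply: leq_trans.
have ex x : x \in trace_fiber b -> exists y, y ^+ p - y == x + iota a / x - beta.
  rewrite inE => /andP[_ /eqP trx].
  have [|y yE] := @tr_eq0 p n L iota p_pr n_gt0 cardL (x + iota a / x - beta).
    by rewrite trD trN trx trx0 subrr.
  by exists y; rewrite yE.
pose Y x := if [pick y | y ^+ p - y == x + iota a / x - beta] is Some y then y else 0.
have YP x : x \in trace_fiber b -> Y x ^+ p - Y x = x + iota a / x - beta.
  by move/ex => [y /eqP yE]; rewrite /Y; case: pickP => [z /eqP //|/(_ y)]; rewrite yE eqxx.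
pose f (u : 'F_p * L) : L * L := (u.2, u.2 * (Y u.2 + iota u.1)).
have -> : (p * #|trace_fiber b|)%N = #|setX [set: 'F_p] (trace_fiber b)|.
  by rewrite cardsX cardsT card_Fp.
rewrite -(card_in_imset (f := f)); last first.
  move=> [i x] [j y] /setXP[_ xb] _ [<-].
  move: xb; rewrite inE => /andP[x0' _] /(mulfI x0') /addrI /fmorph_inj -> //.
apply: subset_leq_card; apply/subsetP => _ /imsetP[[i x] /setXP[_ xb] ->].
have x0' : x != 0 by move: xb; rewrite inE => /andP[].
rewrite inE; apply/eqP/eval2_curve => //=.
have := frobD iota p_pr 1 (Y x) (iota i); rewrite expn1 => ->.
by rewrite -rmorphXn Fp_expp // -YP //; ring.
Qed.

Variable psi : 'F_p -> algC.
Hypotheses (psi_norm : forall x, `|psi x| = 1) (psi_sum : \sum_x psi x = 0).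

(* The upper bounds for all the fibres give lower bounds as well, since the
   fibres partition the units of [L]. *)
Lemma kl_ext_bound :
  `| \sum_(x : L | x != 0) psi (tr (x + iota a / x)) |
     <= ((2 * p ^ 2 + 1) * Q + p ^ 2 + 1)%:R.
Proof.
pose E := ((2 * p ^ 2 + 1) * Q + p ^ 2)%N.
have p0 : (p%:R : algC) != 0 by rewrite pnatr_eq0 -lt0n prime_gt0.
pose U : algC := (Q ^ 2 + E)%N%:R / p%:R.
have sumN : (\sum_b #|trace_fiber b| = (Q ^ 2).-1)%N.
  have cardQ : #|L| = (Q ^ 2)%N by rewrite cardL -expnM mulnC.
  rewrite -cardQ -(cardC1 (0 : L)) -sum1_card.
  rewrite (partition_big (fun x => tr (x + iota a / x)) predT) //=.
  by apply: eq_bigr => b _; rewrite -sum1_card; apply: eq_bigl => x; rewrite !inE.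
have -> : \sum_(x : L | x != 0) psi (tr (x + iota a / x)) =
    \sum_b #|trace_fiber b|%:R * psi b.
  rewrite (partition_big (fun x => tr (x + iota a / x)) predT) //=.
  apply: eq_bigr => b _; rewrite -sum1_card natr_sum mulr_suml.
  apply: eq_big => [x|x /andP[_ /eqP->]]; first by rewrite inE.
  by rewrite mul1r.
(* As [psi] sums to zero, the counts may be replaced by the deficits [U - #|trace_fiber b|], which
   are nonnegative and add up to [p * U - (Q ^ 2 - 1) = E + 1]. *)
have -> : \sum_b #|trace_fiber b|%:R * psi b = - \sum_b (U - #|trace_fiber b|%:R) * psi b.
  rewrite -sumrN; under [RHS]eq_bigr do rewrite mulrBl opprB.
  by rewrite sumrB -mulr_sumr psi_sum mulr0 subr0.
rewrite normrN; apply: le_trans (ler_norm_sum _ _ _) _.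
under eq_bigr => b _.
  rewrite normrM psi_norm mulr1 ger0_norm; last first.
    rewrite subr_ge0 ler_pdivlMr ?ltr0n ?prime_gt0 // -natrM ler_nat mulnC addnA.
    exact: trace_fiber_bound.
  over.
rewrite sumrB sumr_const card_Fp // -natr_sum sumN -[U *+ _]mulr_natr divfK //.
rewrite -natrB ?ler_nat; last by lia.
by rewrite leq_subLR /E; lia.
Qed.

End SumBound.

(** * Sums over monic polynomials *)

Section Monics.
Variable F : finFieldType.
Implicit Types f g P : {poly F}.

Definition polys_lt N : seq {poly F} := [seq rVpoly v | v <- enum 'rV[F]_N].

Lemma polys_lt_uniq N : uniq (polys_lt N).
Proof. by rewrite map_inj_uniq ?enum_uniq //; exact: can_inj rVpolyK. Qed.

Lemma mem_polys_lt N f : (f \in polys_lt N) = (size f <= N)%N.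
Proof.
apply/mapP/idP => [[v _ ->]|sf]; first exact: size_poly.
by exists (poly_rV f); rewrite ?mem_enum ?poly_rV_K.
Qed.

Definition monics n := [seq f <- polys_lt n.+1 | (f \is monic) && (size f == n.+1)].
Definition irrs N := [seq f <- polys_lt N.+1 | (f \is monic) && irreducibleb f].

Lemma monics_uniq n : uniq (monics n).
Proof. by rewrite filter_uniq ?polys_lt_uniq. Qed.
Lemma irrs_uniq n : uniq (irrs n).
Proof. by rewrite filter_uniq ?polys_lt_uniq. Qed.

Lemma mem_monics n f : (f \in monics n) = (f \is monic) && (size f == n.+1).
Proof.
rewrite mem_filter mem_polys_lt -andbA; congr (_ && _).
by case: eqP => //= ->; rewrite leqnn.
Qed.

Lemma mem_irrs N f :
  (f \in irrs N) = [&& f \is monic, irreducibleb f & (size f <= N.+1)%N].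
Proof. by rewrite mem_filter mem_polys_lt andbA. Qed.

Lemma monics0 : monics 0 = [:: 1].
Proof.
apply: perm_small_eq => //; apply: uniq_perm; rewrite ?monics_uniq // => f.
rewrite mem_monics inE; apply/andP/eqP => [[fm /size_poly1P [c c0 fE]]|->].
  by move: fm; rewrite fE monicE lead_coefC => /eqP ->.
by rewrite monic1 size_poly1.
Qed.

Lemma size_monicM f g : f \is monic -> g \is monic ->
  size (f * g) = ((size f).-1 + (size g).-1).+1.
Proof.
move=> fm gm; have f0 := monic_neq0 fm; have g0 := monic_neq0 gm; rewrite size_Mmonic //.
by move: f0 g0; rewrite -!size_poly_gt0; lia.
Qed.

Lemma size_monicX f k : f \is monic -> size (f ^+ k) = (k * (size f).-1).+1.
Proof.
move=> fm; elim: k => [|k IH]; first by rewrite expr0 size_poly1.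
by rewrite exprS size_monicM ?monic_exp // IH mulSn.
Qed.

Lemma monic_factor f : f \is monic -> (1 < size f)%N ->
  exists P g, [/\ P \is monic, irreducible_poly P, g \is monic & f = P * g].
Proof.
move=> fm sf.
have [n] := ubnP (size f); elim: n f fm sf => // n IH f fm sf sn.
have [/irreducibleP irf|red] := boolP (irreducibleb f).
  by exists f, 1; rewrite monic1 mulr1; split.
have [q qf /andP[q1 qs]] : exists2 q : {poly F}, q %| f & (1 < size q < size f)%N.
  move: red; rewrite /irreducibleb sf /= negb_forall => /existsP[q].
  rewrite negb_imply -ltnNge -Pdiv.Idomain.dvdpE => /andP[qf q1].
  exists q => //; rewrite q1 /= (leq_ltn_trans (size_npoly q)) //.
  by rewrite prednK // ltnW.
have q0 : q != 0 by rewrite -size_poly_gt0 ltnW.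
have lq0 : lead_coef q != 0 by rewrite lead_coef_eq0.
pose q' := (lead_coef q)^-1 *: q.
have sq' : size q' = size q by rewrite size_scale ?invr_eq0.
have q'm : q' \is monic by rewrite monicE lead_coefZ mulVf.
have [||P [g [Pm irP gm q'E]]] := IH q' q'm; rewrite ?sq' //; first exact: leq_trans qs _.
have /dvdpP [h fE] : q' %| f by rewrite dvdpZl ?invr_eq0.
have hm : h \is monic by rewrite fE monicMr in fm.
by exists P, (g * h); split; rewrite ?monicMl // mulrA -q'E mulrC.
Qed.

(** The sum of the von Mangoldt function over the monic divisors of [f], with cut-off [N]. *)
Definition irr_powers_dvd N f : nat :=
  (\sum_(P <- irrs N) \sum_(1 <= k < N.+1 | (P ^+ k %| f)%R) (size P).-1)%N.

Lemma irr_coprime P P0 k : P \is monic -> P0 \is monic -> irreducible_poly P ->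
  irreducible_poly P0 -> P != P0 -> coprimep (P ^+ k) P0.
Proof.
move=> Pm P0m irP irP0 PP0; apply: coprimep_expl.
rewrite coprimep_def; apply/negPn/negP => s1.
have E1 := irP _ s1 (dvdp_gcdl _ _); have E2 := irP0 _ s1 (dvdp_gcdr _ _).
by case/negP: PP0; rewrite -eqp_monic // (eqp_trans _ E2) // eqp_sym.
Qed.

Lemma irr_size P : irreducible_poly P -> (0 < (size P).-1)%N.
Proof. by case=> + _; case: (size P) => [|[]]. Qed.

(** Dividing by an irreducible factor [P0] lowers the exponents of [P0] by one, at a loss of the
    degree of [P0], and changes nothing for the other irreducibles. *)
Lemma irr_powers_dvdE N f : f \is monic -> (size f <= N.+1)%N -> irr_powers_dvd N f = (size f).-1.
Proof.
move=> fm sf; have [n] := ubnP (size f); elim: n f fm sf => // n IH f fm sf sn.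
have [s1|s1] := leqP (size f) 1.
  have f1 : f = 1.
    by apply/eqP; rewrite -[_ == _](inE) -monics0 ?mem_monics ?fm //= eqn_leq s1
     size_poly_gt0 monic_neq0.
  rewrite f1 size_poly1 /irr_powers_dvd big_seq big1 // => P.
  rewrite mem_irrs => /and3P[Pm /irreducibleP irP _].
  rewrite big_nat_cond big1 // => k /andP[/andP[k1 _] Pk].
  move: (dvdp_leq (oner_neq0 _) Pk); rewrite size_poly1 size_monicX // ltnS leqn0.
  by rewrite muln_eq0 => /orP[/eqP k0|/eqP ->//]; rewrite k0 in k1.
have [P0 [g [P0m irP0 gm fE]]] := monic_factor fm s1.
have sfE : size f = ((size P0).-1 + (size g).-1).+1 by rewrite fE size_monicM.
have d0 := irr_size irP0; have g0 := monic_neq0 gm.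
have sg0 : (0 < size g)%N by rewrite size_poly_gt0.
have sg : (size g < size f)%N by rewrite sfE; lia.
have := IH g gm (ltnW (leq_trans sg sf)) (leq_trans sg sn).
rewrite sfE /= => <-.
have P0in : P0 \in irrs N.
  rewrite mem_irrs P0m (introT (irreducibleP _) irP0) /=.
  have aux (u v : nat) : (u.-1 + v.-1 < N.+1 -> 0 < u.-1 -> u <= N.+1)%N by lia.
  by apply: (aux _ (size g)) => //; rewrite -sfE.
rewrite /irr_powers_dvd !(bigD1_seq P0) ?irrs_uniq //= addnA; congr (_ + _)%N; last first.
  rewrite big_seq_cond [RHS]big_seq_cond; apply: eq_bigr => P /andP[].
  rewrite mem_irrs => /and3P[Pm /irreducibleP irP _] PP0.
  by apply: eq_bigl => k; rewrite fE Gauss_dvdpr // irr_coprime.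
have N0 : (0 < N)%N by rewrite -ltnS; exact: leq_trans s1 sf.
rewrite big_mkcond big_nat_recl //= expr1 fE dvdp_mulr //; congr addn.
rewrite [RHS]big_mkcond /= -{2}(prednK N0) big_nat_recr // prednK //=.
(* The shift of [k] leaves one surplus index [N], which contributes nothing as the degree of [g] is
   less than [N]. *)
have -> : (P0 ^+ N %| g) = false.
  apply/negP => /(dvdp_leq g0); rewrite size_monicX //.
  have : (size g <= N)%N by rewrite -ltnS; exact: leq_trans sg sf.
  by move=> gN /leq_trans/(_ gN); rewrite ltnNge leq_pmulr.
rewrite addn0; apply: eq_bigr => k _.
by rewrite exprS dvdp_mul2l // monic_neq0.
Qed.

(** * Coefficients of an L-series and of its logarithmic derivative *)

Section Multiplicative.
Variables (K : comNzRingType) (Lam : {poly F} -> K).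
Hypotheses (Lam1 : Lam 1 = 1)
  (LamM : forall f g, f \is monic -> g \is monic -> Lam (f * g) = Lam f * Lam g).

(** With [L(u)] the L-series of [Lam], [Asum] lists the coefficients of [L], and [ssum] those of
    [u L' / L]. *)
Definition Asum n := \sum_(f <- monics n) Lam f.
Definition ssum m := \sum_(P <- irrs m | ((size P).-1 %| m)%N)
   (size P).-1%:R * Lam P ^+ (m %/ (size P).-1).

Lemma Asum0 : Asum 0 = 1. Proof. by rewrite /Asum monics0 big_seq1. Qed.

Lemma LamX f k : f \is monic -> Lam (f ^+ k) = Lam f ^+ k.
Proof.
by move=> fm; elim: k => [|k IH]; rewrite ?expr0 // !exprS LamM ?IH ?monic_exp.
Qed.

Lemma sum_multiples D n : D \is monic ->
  \sum_(f <- monics n | D %| f) Lam f =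
  if ((size D).-1 <= n)%N then Lam D * Asum (n - (size D).-1) else 0.
Proof.
move=> Dm; have D0 := monic_neq0 Dm.
have sD : (0 < size D)%N by rewrite size_poly_gt0.
case: leqP => [Dn|nD]; last first.
  rewrite big_seq_cond big1 // => f; rewrite mem_monics => /andP[/andP[fm /eqP sf]].
  have aux (u : nat) : (u <= n.+1 -> n < u.-1 -> False)%N by lia.
  by move/(dvdp_leq (monic_neq0 fm)); rewrite sf => /aux/(_ nD).
rewrite -big_filter /Asum mulr_sumr.
rewrite (perm_big [seq D * g | g <- monics (n - (size D).-1)]) /=; last first.
  apply: uniq_perm.
  - exact: filter_uniq (monics_uniq n).
  - by rewrite map_inj_uniq ?monics_uniq //; exact: mulfI.
  move=> f; rewrite mem_filter mem_monics; apply/and3P/mapP.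
    move=> [/dvdpP[g fE] fm /eqP sf].
    have gm : g \is monic by rewrite fE monicMr in fm.
    exists g; last by rewrite mulrC.
    have aux (u v : nat) : ((u.-1 + v).+1 = n.+1 -> 0 < u -> u = (n - v).+1)%N by lia.
    rewrite mem_monics gm; move: sf; rewrite fE size_monicM // => /aux.
    by rewrite size_poly_gt0 monic_neq0 // => /(_ isT) ->; rewrite eqxx.
  move=> [g]; rewrite mem_monics => /andP[gm /eqP sg] ->.
  rewrite dvdp_mulr // monicMl // size_monicM // sg; split=> //=.
  by rewrite subnKC.
rewrite big_map big_seq [RHS]big_seq; apply: eq_bigr => g.
by rewrite mem_monics => /andP[gm _]; rewrite LamM.
Qed.

Lemma ssumE N m : (0 < m <= N)%N -> ssum m = \sum_(P <- irrs N)
  \sum_(1 <= k < N.+1 | (k * (size P).-1 == m)%N) (size P).-1%:R * Lam P ^+ k.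
Proof.
move=> /andP[m0 mN]; rewrite /ssum.
have -> : \sum_(P <- irrs m | ((size P).-1 %| m)%N)
     (size P).-1%:R * Lam P ^+ (m %/ (size P).-1) =
   \sum_(P <- irrs N | ((size P).-1 %| m)%N)
     (size P).-1%:R * Lam P ^+ (m %/ (size P).-1).
  rewrite -big_filter -[RHS]big_filter; apply: perm_big; apply: uniq_perm.
  - by rewrite filter_uniq ?irrs_uniq.
  - by rewrite filter_uniq ?irrs_uniq.
  move=> P; rewrite [LHS]mem_filter [RHS]mem_filter !mem_irrs; case dm: (_ %| _)%N => //=.
  have aux (u : nat) : (u.-1 <= m -> (u <= m.+1) = (u <= N.+1))%N by lia.
  by rewrite (aux _ (dvdn_leq m0 dm)).
rewrite big_mkcond; apply: eq_big_seq => P; rewrite mem_irrs.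
move=> /and3P[Pm /irreducibleP /irr_size d0 _]; set d := (size P).-1 in d0 *.
case: ifPn => [/dvdnP[k mE]|dm].
  have k0 : (0 < k)%N by move: m0; rewrite mE; case: (k).
  have kN : (k <= N)%N by apply: leq_trans mN; rewrite mE leq_pmulr.
  rewrite mE mulnK // [RHS]big_mkcond (bigD1_seq k) ?iota_uniq ?mem_index_iota //=;
    last by rewrite k0 ltnS.
  rewrite eqxx big1 ?addr0 // => j jk.
  by rewrite eqn_pmul2r // (negbTE jk).
rewrite big1 // => k /eqP E; by rewrite -E dvdn_mull in dm.
Qed.

(** This is [u L' = (u L' / L) L]. For [f] monic of degree [n], [irr_powers_dvd n f = n]; after
    exchanging sums, the multiples of [P ^+ k] contribute [Lam P ^+ k * Asum (n - k * d)], with [d]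
    the degree of [P]. *)
Lemma newton n : Asum n *+ n = \sum_(1 <= m < n.+1) ssum m * Asum (n - m).
Proof.
transitivity (\sum_(f <- monics n) Lam f *+ irr_powers_dvd n f).
  rewrite /Asum -sumrMnl; apply: eq_big_seq => f.
  by rewrite mem_monics => /andP[fm /eqP sf]; rewrite irr_powers_dvdE ?sf.
transitivity (\sum_(P <- irrs n) \sum_(1 <= k < n.+1)
    (size P).-1%:R * \sum_(f <- monics n | P ^+ k %| f) Lam f).
  under eq_bigr => f _.
    rewrite /irr_powers_dvd -mulr_natl natr_sum mulr_suml.
    under eq_bigr do rewrite natr_sum mulr_suml big_mkcond.
    over.
  rewrite exchange_big /=; apply: eq_bigr => P _.
  rewrite exchange_big /=; apply: eq_bigr => k _.
  by rewrite mulr_sumr -big_mkcond.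
transitivity (\sum_(1 <= m < n.+1) \sum_(P <- irrs n) 
   \sum_(1 <= k < n.+1 | (k * (size P).-1 == m)%N)
     (size P).-1%:R * Lam P ^+ k * Asum (n - m)); last first.
  apply: eq_big_nat => m m_n; rewrite (@ssumE n m) // mulr_suml.
  by apply: eq_bigr => P _; rewrite mulr_suml.
rewrite [RHS]exchange_big /=; apply: eq_big_seq => P; rewrite mem_irrs.
move=> /and3P[Pm /irreducibleP /irr_size d0 _]; set d := (size P).-1 in d0 *.
rewrite [RHS](exchange_big_dep_nat predT) //=.
apply: eq_big_nat => k /andP[k1 kn].
rewrite sum_multiples ?monic_exp // size_monicX //= -/d LamX //.
have kd0 : (0 < k * d)%N by rewrite muln_gt0 k1.
case: leqP => kd; last first.
  rewrite mulr0 big_nat_cond big1 // => m /andP[/andP[_ mn] /eqP E].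
  by rewrite E ltnNge -ltnS mn in kd.
rewrite big_mkcond (bigD1_seq (k * d)%N) ?iota_uniq ?mem_index_iota ?kd0 //=.
rewrite eqxx big1 ?addr0 ?mulrA // => m; rewrite eq_sym => /negbTE -> //.
Qed.
End Multiplicative.
End Monics.

(** * Sums over irreducible polynomials and over extension fields *)

Lemma monicsE (F : finFieldType) n :
  perm_eq (monics F n) [seq 'X^n + rVpoly v | v <- enum 'rV[F]_n].
Proof.
apply: uniq_perm; first exact: monics_uniq.
  rewrite map_inj_uniq ?enum_uniq // => u v /addrI; exact: (can_inj rVpolyK).
move=> f; rewrite mem_monics; apply/andP/mapP => [[fm /eqP sf]|[v _ ->]].
  exists (poly_rV (f - 'X^n)); first by rewrite mem_enum.
  rewrite poly_rV_K; first by rewrite addrC subrK.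
  apply/leq_sizeP => j nj; rewrite coefB coefXn.
  move: nj; rewrite leq_eqVlt => /orP[/eqP <-|nj].
    by rewrite eqxx -[n in f`_n]/(n.+1.-1) -sf -lead_coefE (monicP fm) subrr.
  by rewrite nth_default ?sf // (gtn_eqF nj) subrr.
have sv : (size (rVpoly v) < size ('X^n : {poly F})%R)%N.
  by rewrite size_polyXn ltnS size_poly.
by rewrite monicE lead_coefDl // lead_coefXn eqxx size_polyDl // size_polyXn.
Qed.

Lemma size_monics (F : finFieldType) n : size (monics F n) = (#|F| ^ n)%N.
Proof.
by rewrite (perm_size (monicsE F n)) size_map -cardE card_mx mul1n.
Qed.

(** Newton's identity for the constant function 1, where [Asum n = #|F| ^ n]: on the right of the
    identity of index [m], all terms but the last add up to [#|F|] times the right of the identity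
    of index [m.-1]. *)
Lemma sum_deg_irrs (F : finFieldType) m : (0 < m)%N ->
  (\sum_(P <- irrs F m | ((size P).-1 %| m)%N) (size P).-1 = #|F| ^ m)%N.
Proof.
case: m => // m _; pose s := @ssum F int (fun=> 1).
have AE n : @Asum F int (fun=> 1) n = (#|F| ^ n)%N%:R.
  by rewrite /Asum big_const_seq count_predT size_monics iter_addr_0.
have nw n : @Asum F int (fun=> 1) n *+ n = \sum_(1 <= k < n.+1) s k * @Asum F int (fun=> 1) (n - k).
  by apply: (@newton F int (fun=> 1)) => *; rewrite ?mulr1.
suff : s m.+1 = (#|F| ^ m.+1)%N%:R.
  move=> E; apply/eqP; rewrite -(eqr_nat int) -E natr_sum; apply/eqP/eq_bigr => P _.
  by rewrite expr1n mulr1.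
have := nw m.+1; rewrite big_nat_recr //= subnn Asum0 // mulr1.
under eq_big_nat => k /andP[_ km].
  rewrite AE subSn // expnSr natrM mulrA -AE; over.
rewrite -mulr_suml -nw !AE mulrnAl -natrM -expnSr [LHS]mulrSr.
by move/addrI => ->.
Qed.

Section FieldSum.
Variables (p m : nat) (L : finFieldType) (iota : {rmorphism 'F_p -> L}).
Hypotheses (p_pr : prime p) (m_gt0 : (0 < m)%N) (cardL : #|L| = (p ^ m)%N).

Lemma frob_inj k (x y : L) : x ^+ (p ^ k) = y ^+ (p ^ k) -> x = y.
Proof.
move=> E; apply/eqP; rewrite -subr_eq0.
have : (x - y) ^+ (p ^ k) == 0 by rewrite (frobD iota) // (frobN iota) // E subrr.
by rewrite expf_eq0 => /andP[].
Qed.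

Lemma descend (g : {poly L}) : (forall i, g`_i ^+ p = g`_i) ->
  exists P, map_poly iota P = g.
Proof.
move=> gp; pose h c : 'F_p := odflt 0 [pick k | iota k == c].
have hK i : iota (h g`_i) = g`_i.
  rewrite /h; case: pickP => [k /eqP //|]; have [k <-] := frob_fix iota p_pr (gp i).
  by move/(_ k); rewrite eqxx.
exists (\poly_(i < size g) h g`_i); apply/polyP => i.
rewrite coef_map coef_poly; case: ltnP => [_|si]; first exact: hK.
by rewrite nth_default //; exact: (rmorph0 iota).
Qed.

(** For [k = m], the characteristic polynomial of [x] over the prime field. *)
Definition conj_prod k (x : L) : {poly L} := \prod_(0 <= i < k) ('X - (x ^+ (p ^ i))%:P).

Lemma conj_prod_monic k x : conj_prod k x \is monic.
Proof. by apply: monic_prod => i _; rewrite monicXsubC. Qed.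

Lemma size_conj_prod k x : size (conj_prod k x) = k.+1.
Proof. by rewrite /conj_prod size_prod_XsubC /index_iota size_iota subn0. Qed.

Lemma conj_prod_descend k x : (0 < k)%N -> x ^+ (p ^ k) = x ->
  exists P, map_poly iota P = conj_prod k x.
Proof.
move=> k0 xk; apply: descend => i.
pose phi := pFrobenius_aut (pcharL iota p_pr).
suff : map_poly phi (conj_prod k x) = conj_prod k x.
  by move=> {2}<-; rewrite coef_map /= /phi pFrobenius_autE.
rewrite /conj_prod rmorph_prod /=.
under eq_bigr => j _.
  rewrite rmorphB /= map_polyX map_polyC /= /phi pFrobenius_autE -exprM -expnSr.
  over.
case: k k0 xk => // k _ xk.
by rewrite big_nat_recr // big_nat_recl //= xk expn0 expr1 mulrC.
Qed.

Lemma root_conj k (x : L) (P : {poly 'F_p}) :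
  root (map_poly iota P) x -> root (map_poly iota P) (x ^+ (p ^ k)).
Proof.
elim: k => [|k IH]; first by rewrite expr1.
move/IH; rewrite expnSr exprM; set y := x ^+ _; rewrite !rootE => /eqP Py.
have := congr1 (fun z => pFrobenius_aut (pcharL iota p_pr) z) Py.
rewrite -horner_map /= rmorph0 pFrobenius_autE => E; apply/eqP; rewrite -[RHS]E.
rewrite -map_poly_comp; congr (_.[_]); apply: eq_map_poly => c /=.
by rewrite pFrobenius_autE -rmorphXn Fp_expp.
Qed.

(** With [d] the least period of [x] under Frobenius, [P] is the product over the [d] conjugates. It
    is irreducible because a nonzero polynomial over the prime field that vanishes at [x] vanishes
    at all [d] conjugates, which are distinct; [conj_prod m x] runs through them [m / d] times. *)
Lemma min_poly (x : L) : exists P : {poly 'F_p},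
  [/\ P \is monic, irreducible_poly P, ((size P).-1 %| m)%N,
      root (map_poly iota P) x & map_poly iota (P ^+ (m %/ (size P).-1)) = conj_prod m x].
Proof.
have xm : x ^+ (p ^ m) = x by rewrite -cardL expf_card.
have ex : exists k, (0 < k)%N && (x ^+ (p ^ k) == x) by exists m; rewrite m_gt0 xm eqxx.
case: (ex_minnP ex) => d /andP[d0 /eqP xd] dmin.
have xmul k i : x ^+ (p ^ (k * d + i)) = x ^+ (p ^ i).
  elim: k => [|k IH]; first by rewrite add0n.
  by rewrite mulSn -addnA expnD exprM xd IH.
have dm : (d %| m)%N.
  rewrite /dvdn; apply: contraLR (ltn_pmod m d0); rewrite -lt0n -leqNgt => r0.
  by apply: dmin; rewrite r0 /= -(xmul (m %/ d)%N) -divn_eq xm.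
have [P PE] := conj_prod_descend d0 xd.
have Pm : P \is monic by have := conj_prod_monic d x; rewrite -PE map_monic.
have sP : size P = d.+1 by rewrite -(size_map_poly iota) PE size_conj_prod.
have distinct i j : (i < j < d)%N -> x ^+ (p ^ i) != x ^+ (p ^ j).
  move=> /andP[ij jd]; apply/eqP => E.
  have : x ^+ (p ^ (j - i)) = x.
    by apply: (@frob_inj i); rewrite -exprM -expnD subnK ?(ltnW ij).
  move/eqP => E'; have := dmin (j - i)%N; rewrite subn_gt0 ij E' => /(_ isT).
  by apply/negP; rewrite -ltnNge (leq_ltn_trans (leq_subr _ _)).
have uniq_conj : uniq [seq x ^+ (p ^ i) | i <- seq.iota 0 d].
  rewrite map_inj_in_uniq ?iota_uniq // => i j; rewrite !mem_iota !add0n /= => id jd E.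
  by case: (ltngtP i j) => // ij; [have := distinct i j | have := distinct j i];
    rewrite ij ?id ?jd E eqxx => /(_ isT).
have big (q : {poly 'F_p}) : q != 0 -> root (map_poly iota q) x -> (d < size q)%N.
  move=> q0 rx; rewrite -(size_map_poly iota).
  have := @max_poly_roots _ (map_poly iota q) [seq x ^+ (p ^ i) | i <- seq.iota 0 d].
  rewrite size_map size_iota; apply=> //; first by rewrite map_poly_eq0.
  by apply/allP => _ /mapP[i _ ->]; exact: root_conj.
have rootP : root (map_poly iota P) x.
  rewrite PE /conj_prod rootE horner_prod big_ltn //= expr1 hornerXsubC subrr mul0r //.
exists P; split=> //; last first.
- rewrite sP /= rmorphXn /= PE -[in RHS](divnK dm).
  elim: (m %/ d)%N => [|k IH]; first by rewrite mul0n expr0 /conj_prod big_geq.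
  have -> : conj_prod (k.+1 * d) x =
      conj_prod (k * d) x * \prod_(k * d <= i < k * d + d) ('X - (x ^+ (p ^ i))%:P).
    by rewrite mulSn addnC /conj_prod -big_cat_nat ?leq_addr.
  rewrite exprS IH mulrC; congr (_ * _); rewrite -{1}[(k * d)%N]add0n big_addn addKn.
  by apply: eq_bigr => i _; rewrite addnC xmul.
- by rewrite sP.
split; first by rewrite sP ltnS.
move=> q q1 /dvdpP[h hE].
have P0 := monic_neq0 Pm.
have hq0 : h * q != 0 by rewrite -hE monic_neq0.
have [h0 q0] : h != 0 /\ q != 0 by apply/andP; rewrite -negb_or -mulf_eq0.
have := size_mul h0 q0; rewrite -hE sP => sE.
have qP : q %| P by rewrite hE dvdp_mull.
move: rootP; rewrite hE rmorphM rootM => /orP[/(big _ h0)|/(big _ q0)] lt.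
  have aux (u v : nat) : (d.+1 = (u + v).-1 -> d < u -> 0 < v -> v = 1)%N by lia.
  by case/negP: q1; rewrite (aux _ _ sE lt) // size_poly_gt0.
have aux (u v : nat) : (d.+1 = (u + v).-1 -> d < v -> 0 < u -> v = d.+1)%N by lia.
by rewrite -hE -dvdp_size_eqp // sP (aux _ _ sE lt) // size_poly_gt0.
Qed.

Lemma common_root_eq (P P' : {poly 'F_p}) x : P \is monic -> P' \is monic ->
  irreducible_poly P -> irreducible_poly P' ->
  root (map_poly iota P) x -> root (map_poly iota P') x -> P = P'.
Proof.
move=> Pm P'm irP irP' rP rP'; apply/eqP; apply/negPn/negP => PP'.
have := @irr_coprime _ P P' 1 Pm P'm irP irP' PP'; rewrite expr1 => cop.
have : coprimep (map_poly iota P) (map_poly iota P') by rewrite coprimep_map.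
by move/coprimep_root/(_ rP); rewrite -rootE rP'.
Qed.

Lemma sum_over_roots (K : nmodType) (G : {poly 'F_p} -> K) (x : L) (P : {poly 'F_p}) :
  P \is monic -> irreducible_poly P -> ((size P).-1 %| m)%N ->
  root (map_poly iota P) x ->
  \sum_(P' <- irrs 'F_p m | ((size P').-1 %| m)%N && root (map_poly iota P') x) G P' = G P.
Proof.
move=> Pm irP dm rP; rewrite big_mkcond (bigD1_seq P) ?irrs_uniq //=; last first.
  rewrite mem_irrs Pm (introT (irreducibleP _) irP) /=.
  have aux (u : nat) : (u.-1 <= m -> u <= m.+1)%N by lia.
  exact/aux/(dvdn_leq m_gt0 dm).
rewrite dm rP /= big_seq_cond big1 ?addr0 // => P' /andP[].
rewrite mem_irrs => /and3P[P'm /irreducibleP irP' _] PP'.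
case: ifP => // /andP[_ rP']; case/eqP: PP'.
exact: common_root_eq rP' rP.
Qed.

Definition nroots (P : {poly 'F_p}) := #|[set x | root (map_poly iota P) x]|.

(* Each root number is at most the degree; both total [p ^ m]. *)
Lemma nroots_irr P : P \in irrs 'F_p m -> ((size P).-1 %| m)%N -> nroots P = (size P).-1.
Proof.
have le P' : P' \in irrs 'F_p m -> (nroots P' <= (size P').-1)%N.
  rewrite mem_irrs => /and3P[P'm _ _].
  have := @roots_card_le L (map_poly iota P') [set x | root (map_poly iota P') x].
  rewrite map_poly_eq0 monic_neq0 // size_map_poly => /(_ isT) H.
  have aux (u v : nat) : (u < v -> u <= v.-1)%N by lia.
  by apply/aux/H => y; rewrite inE.
have tot : (\sum_(P' <- irrs 'F_p m | ((size P').-1 %| m)%N) nroots P' = p ^ m)%N.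
  under eq_bigr do rewrite /nroots -sum1_card big_mkcond /=.
  rewrite exchange_big /= -cardL -sum1_card; apply: eq_bigr => x _.
  have [P' [P'm irP' dm rP' _]] := min_poly x.
  rewrite -[RHS](@sum_over_roots nat (fun=> 1%N) x P' P'm irP' dm rP').
  rewrite [RHS]big_mkcond /= big_mkcond /=.
  apply: eq_bigr => P'' _; rewrite inE; by case: (_ %| _)%N.
move=> Pin dm; apply/eqP; rewrite eqn_leq le //=.
have := sum_deg_irrs 'F_p m_gt0; rewrite card_Fp // -tot.
rewrite !(big_mkcond (fun P' => _ %| _)%N) !(bigD1_seq P) ?irrs_uniq //= dm.
set a := (X in (_ + X)%N); set b := (X in (_ = _ + X)%N) => E.
have : (b <= a)%N.
  rewrite /a /b big_seq_cond [X in (_ <= X)%N]big_seq_cond; apply: leq_sum => P' /andP[P'in _].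
  by case: ifP => // _; apply: le.
have aux (u v w z : nat) : (u + w = v + z -> z <= w -> u <= v)%N by lia.
exact: aux E.
Qed.

Variables (K : comNzRingType) (Lam : {poly 'F_p} -> K).
Hypotheses (Lam1 : Lam 1 = 1)
  (LamM : forall f g, f \is monic -> g \is monic -> Lam (f * g) = Lam f * Lam g).

(** Group the [x] by minimal polynomial: an irreducible [P] of degree [d] dividing [m] has [d]
    roots, each with characteristic polynomial [P ^+ (m / d)]. *)
Lemma ssum_field (C : L -> {poly 'F_p}) :
  (forall x, map_poly iota (C x) = conj_prod m x) ->
  ssum Lam m = \sum_x Lam (C x).
Proof.
move=> CE; transitivity (\sum_x \sum_(P <- irrs 'F_p m | ((size P).-1 %| m)%N
     && root (map_poly iota P) x) Lam P ^+ (m %/ (size P).-1)); last first.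
  apply: eq_bigr => x _; have [P [Pm irP dm rP PE]] := min_poly x.
  rewrite (sum_over_roots _ Pm irP dm rP) -LamX //; congr Lam.
  by apply: (map_poly_inj iota); rewrite CE.
under [RHS]eq_bigr do rewrite big_mkcond /=.
rewrite exchange_big /= /ssum big_mkcond; apply: eq_big_seq => P Pin.
case: ifP => dm; last by rewrite big1.
rewrite -big_mkcond sumr_const /= mulr_natl; congr (_ *+ _).
by rewrite -(nroots_irr Pin dm) /nroots cardsE.
Qed.

End FieldSum.

(** * The L-function of a Kloosterman sum *)

Section TopBottom.
Variable E : fieldType.
Implicit Types f g : {poly E}.

(** For monic [f], minus the sum of the roots. The factor ['X] yields 0, not the leading
    coefficient, when [f] is constant. *)
Definition subtop f := ('X * f)`_(size f).-1.

Lemma subtopM f g : f \is monic -> g \is monic -> subtop (f * g) = subtop f + subtop g.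
Proof.
move=> fm gm; rewrite /subtop !coefXM.
have s0 (h : {poly E}) : h \is monic -> (0 < size h)%N by move=> hm; rewrite size_poly_gt0 monic_neq0.
have lf : f`_(size f).-1 = 1 by rewrite -lead_coefE (monicP fm).
have lg : g`_(size g).-1 = 1 by rewrite -lead_coefE (monicP gm).
have sfg : (size (f * g)).-1 = ((size f).-1 + (size g).-1)%N.
  by rewrite size_mul ?monic_neq0 //; have := s0 f fm; have := s0 g gm;
  move: (size f) (size g) => u v; lia.
rewrite sfg.
case df: (size f).-1 => [|m].
  have -> : f = 1.
    by rewrite [f]size1_polyC ?lead_coefE -?df ?lf //; move: (s0 f fm) df; move: (size f); lia.
  by rewrite mul1r add0n add0r.
case dg: (size g).-1 => [|n].
  have -> : g = 1.
    by rewrite [g]size1_polyC ?lead_coefE -?dg ?lg //; move: (s0 g gm) dg; move: (size g); lia.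
  by rewrite mulr1 addn0 addr0.
rewrite addSn /= addnS /=.
have sf : size f = m.+2 by move: (s0 f fm) df; move: (size f); lia.
have sg : size g = n.+2 by move: (s0 g gm) dg; move: (size g); lia.
rewrite coefM.
have i1 : (m < (m + n).+2)%N by lia.
have i2 : (m.+1 < (m + n).+2)%N by lia.
rewrite (bigD1 (Ordinal i1)) //= (bigD1 (Ordinal i2)) /=; last by rewrite -val_eqE /= gtn_eqF.
rewrite df in lf; rewrite dg in lg; rewrite big1 ?addr0; last first.
  move=> i; rewrite -!val_eqE /= => /andP[im im1].
  have [lt|ge] := ltnP i m.
    by rewrite [g`__]nth_default ?mulr0 // sg; move: lt; lia.
  rewrite nth_default ?mul0r // sf; move: im im1 ge; lia.
by rewrite subSS addKn -addnS addKn lf lg mulr1 mul1r.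
Qed.

(** The logarithmic derivative at 0, which is minus the sum of the inverses of the roots. *)
Definition logder0 f := f`_1 / f`_0.

Lemma logder0M f g : f`_0 != 0 -> g`_0 != 0 -> logder0 (f * g) = logder0 f + logder0 g.
Proof.
move=> f0 g0; rewrite /logder0 coef0M coefM !big_ord_recl big_ord0 /= /bump /=.
by field; rewrite f0 g0.
Qed.

Lemma subtop_prod k (r : nat -> E) :
  subtop (\prod_(0 <= i < k) ('X - (r i)%:P)) = - \sum_(0 <= i < k) r i.
Proof.
elim: k => [|k IH]; first by rewrite !big_geq // /subtop coefXM size_poly1 oppr0.
rewrite !big_nat_recr //= subtopM ?monicXsubC ?monic_prod_XsubC //.
rewrite IH opprD; congr (_ + _).
by rewrite /subtop size_XsubC coefXM /= coefB coefX coefC sub0r.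
Qed.

Lemma logder0_prod k (r : nat -> E) : (forall i, r i != 0) ->
  (\prod_(0 <= i < k) ('X - (r i)%:P))`_0 != 0 /\
  logder0 (\prod_(0 <= i < k) ('X - (r i)%:P)) = - \sum_(0 <= i < k) (r i)^-1.
Proof.
move=> r0; elim: k => [|k [IH0 IH]].
  by rewrite !big_geq // /logder0 !coef1 oppr0 mul0r oner_neq0.
have c0 : ('X - (r k)%:P)`_0 != 0 by rewrite coefB coefX coefC sub0r oppr_eq0.
rewrite !big_nat_recr //= logder0M // coef0M mulf_neq0 //; split=> //.
rewrite IH opprD; congr (_ + _).
by rewrite /logder0 !coefB !coefX !coefC /= subr0 sub0r invrN mulrN mul1r.
Qed.

End TopBottom.

Lemma map_subtop (E E' : fieldType) (f : {rmorphism E -> E'}) (P : {poly E}) :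
  subtop (map_poly f P) = f (subtop P).
Proof. by rewrite /subtop !coefXM size_map_poly coef_map /=; case: eqP => // _; rewrite rmorph0. Qed.

Lemma map_logder0 (E E' : fieldType) (f : {rmorphism E -> E'}) (P : {poly E}) :
  logder0 (map_poly f P) = f (logder0 P).
Proof. by rewrite /logder0 !coef_map /= fmorph_div. Qed.

Section KloostermanL.
Variables (p : nat) (p_pr : prime p) (psi : 'F_p -> algC) (a : 'F_p).
Hypotheses (psi_norm : forall x, `|psi x| = 1) (psi_sum : \sum_x psi x = 0)
  (psiD : forall x y, psi (x + y) = psi x * psi y) (a_neq0 : a != 0).

Definition kl := \sum_(x : 'F_p | x != 0) psi (x + a / x).

(** On a monic polynomial with nonzero roots [r_i] this is [psi] of the sum of all [r_i + a / r_i],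
    whence multiplicativity. *)
Definition klam (f : {poly 'F_p}) : algC :=
  if f`_0 == 0 then 0 else psi (- subtop f - a * logder0 f).

Lemma psi_neq0 x : psi x != 0.
Proof. by rewrite -normr_eq0 psi_norm oner_neq0. Qed.

Lemma psi0 : psi 0 = 1.
Proof. by apply: (mulfI (psi_neq0 0)); rewrite -psiD addr0 mulr1. Qed.

Lemma psiN x : psi (- x) = (psi x)^*.
Proof.
apply: (mulfI (psi_neq0 x)); rewrite -psiD subrr psi0 -normCK psi_norm expr1n //.
Qed.

Lemma psi_lin_sum c : c != 0 -> \sum_x psi (x * c) = 0.
Proof.
move=> c0; rewrite -[RHS]psi_sum; exact/esym/(reindex_inj (mulIf c0)).
Qed.

Lemma klam1 : klam 1 = 1.
Proof.
rewrite /klam /subtop /logder0 size_poly1 coefXM !coef1 !eqxx (negbTE (oner_neq0 _)).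
by rewrite mul0r mulr0 subr0 oppr0 psi0.
Qed.

Lemma klamM f g : f \is monic -> g \is monic -> klam (f * g) = klam f * klam g.
Proof.
move=> fm gm; rewrite /klam coef0M mulf_eq0.
case: eqP => [|/eqP f0]; first by rewrite mul0r.
case: eqP => [|/eqP g0]; first by rewrite mulr0.
by rewrite /= -psiD subtopM // logder0M //; congr psi; ring.
Qed.

(* The coefficients of index 0 and 1 are not affected when [2 < n]. *)
Lemma klam_shift n (f : {poly 'F_p}) (c : 'F_p) : (2 < n)%N -> f \in monics 'F_p n ->
  klam (f + c *: 'X^(n.-1)) = psi (- c) * klam f.
Proof.
move=> n2; rewrite mem_monics => /andP[fm /eqP sf].
have sf' : size (f + c *: 'X^(n.-1)) = n.+1.
  rewrite size_polyDl sf // (leq_ltn_trans (size_scale_leq _ _)) // size_polyXn.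
  by rewrite ltnS prednK // ltnW // ltnW.
rewrite /klam /subtop /logder0 sf sf' !coefXM !coefD !coefZ !coefXn.
have [-> -> ->] : [/\ (0 == n.-1)%N = false, (1 == n.-1)%N = false & (n == 0)%N = false].
  by split; apply/eqP; lia.
rewrite !mulr0 !addr0 /= eqxx mulr1; case: eqP => _; first by rewrite mulr0.
by rewrite -psiD; congr psi; rewrite ?mulr1; ring.
Qed.

Lemma monics_shift n c : (0 < n)%N ->
  perm_eq (monics 'F_p n) [seq f + c *: 'X^(n.-1) | f <- monics 'F_p n].
Proof.
move=> n0; apply: uniq_perm; first exact: monics_uniq.
  by rewrite map_inj_uniq ?monics_uniq //; exact: addIr.
have shift c' f : f \in monics 'F_p n -> f + c' *: 'X^(n.-1) \in monics 'F_p n.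
  rewrite !mem_monics => /andP[fm /eqP sf].
  have lt : (size (c' *: 'X^(n.-1) : {poly 'F_p})%R < size f)%N.
    by rewrite sf (leq_ltn_trans (size_scale_leq _ _)) // size_polyXn ltnS prednK.
  by rewrite monicE lead_coefDl // size_polyDl // sf eqxx andbT.
move=> f; apply/idP/mapP => [fin|[g gin ->]]; last exact: shift.
exists (f + (- c) *: 'X^(n.-1)); first exact: shift.
by rewrite scaleNr subrK.
Qed.

(** Adding [c *: 'X^(n.-1)] permutes the monic polynomials and multiplies the sum by [psi (- c)],
    which differs from 1 for some [c]. *)
Lemma Asum_klam_gt2 n : (2 < n)%N -> Asum klam n = 0.
Proof.
move=> n2.
have [c c1] : exists c, psi (- c) != 1.
  apply/existsP; rewrite -negb_forall; apply/negP => /forallP H.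
  have : \sum_x psi x = p%:R.
    rewrite (eq_bigr (fun=> 1)) => [|x _]; first by rewrite sumr_const card_Fp.
    by rewrite -[x]opprK; apply/eqP.
  by move/eqP; rewrite psi_sum eq_sym pnatr_eq0 -leqn0 leqNgt prime_gt0.
have E : Asum klam n = psi (- c) * Asum klam n.
  rewrite {1}/Asum (perm_big _ (@monics_shift n c (ltnW (ltnW n2)))) big_map mulr_sumr.
  by apply: eq_big_seq => f fin; rewrite klam_shift.
apply/eqP; have : (psi (- c) - 1) * Asum klam n == 0 by rewrite mulrBl mul1r -E subrr.
by rewrite mulf_eq0 subr_eq0 (negbTE c1).
Qed.

Lemma Asum_klam1 : Asum klam 1 = kl.
Proof.
rewrite /Asum (perm_big [seq 'X - x%:P | x <- enum 'F_p]) /=; last first.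
  apply: uniq_perm; rewrite ?monics_uniq //.
    by rewrite map_inj_uniq ?enum_uniq // => u v /addrI /oppr_inj /polyC_inj.
  move=> f; rewrite mem_monics; apply/andP/mapP => [[fm /eqP sf]|[x _ ->]]; last first.
    by rewrite monicXsubC size_XsubC.
  exists (- f`_0); first by rewrite mem_enum.
  apply/polyP => -[|[|i]]; rewrite coefB coefX coefC /= ?subr0 ?sub0r ?opprK //.
    by move: (monicP fm); rewrite lead_coefE sf.
  by rewrite nth_default // sf.
rewrite big_map big_enum /= /kl [RHS]big_mkcond; apply: eq_bigr => x _.
rewrite /klam coefB coefX coefC sub0r oppr_eq0; case: eqP => //= /eqP x0.
rewrite /subtop /logder0 size_XsubC coefXM !coefB !coefX !coefC /= subr0 sub0r opprK.
by rewrite invrN !mulrN opprK mul1r.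
Qed.

Lemma klam_quad u v : klam ('X^2 + (u *: 'X + v%:P)) =
  if v == 0 then 0 else psi (u * (- 1 - a / v)).
Proof.
have lt : (size (u *: 'X + v%:P : {poly 'F_p})%R < size ('X^2 : {poly 'F_p})%R)%N.
  rewrite size_polyXn ltnS (leq_trans (size_polyD _ _)) // geq_max.
  rewrite (leq_trans (size_scale_leq _ _)) ?size_polyX //.
  by rewrite (leq_trans (size_polyC_leq1 _)).
rewrite /klam /subtop /logder0 size_polyDl // size_polyXn coefXM !coefD !coefZ.
rewrite !coefXn !coefX !coefC /= !mulr0 !mulr1 !add0r !addr0.
by case: eqP => //= /eqP v0; congr psi; field.
Qed.

(** For a fixed constant term [v != 0] the summand is a character in [u] with slope [- 1 - a / v];
    its sum vanishes unless [v = - a], where all [p] summands are 1. *)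
Lemma Asum_klam2 : Asum klam 2 = p%:R.
Proof.
rewrite /Asum (perm_big [seq 'X^2 + (u *: 'X + v%:P) | v <- enum 'F_p, u <- enum 'F_p]) /=; last first.
  apply: uniq_perm; rewrite ?monics_uniq //.
    rewrite allpairs_uniq ?enum_uniq // => -[u v] [u' v'] _ _ /= /addrI E.
    have := congr1 (fun P : {poly 'F_p} => P`_0) E.
    have := congr1 (fun P : {poly 'F_p} => P`_1) E.
    by rewrite !coefD !coefZ !coefX !coefC /= !mulr0 !mulr1 !addr0 !add0r => -> ->.
  move=> f; rewrite mem_monics; apply/andP/allpairsP => [[fm /eqP sf]|[[u v] [_ _ ->]]].
    exists (f`_0, f`_1); split; rewrite ?mem_enum //.
    apply/polyP => -[|[|[|i]]]; rewrite !coefD coefZ coefXn coefX coefC /= ?mulr0 ?mulr1 ?addr0 ?add0r //.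
      by move: (monicP fm); rewrite lead_coefE sf.
    by rewrite nth_default // sf.
  have lt : (size (v *: 'X + u%:P : {poly 'F_p})%R < size ('X^2 : {poly 'F_p})%R)%N.
    rewrite size_polyXn ltnS (leq_trans (size_polyD _ _)) // geq_max.
    rewrite (leq_trans (size_scale_leq _ _)) ?size_polyX //.
    by rewrite (leq_trans (size_polyC_leq1 _)).
  by rewrite monicE lead_coefDl // lead_coefXn size_polyDl // size_polyXn.
rewrite big_allpairs_dep big_enum /= (bigD1 (- a)) //= [X in _ + X]big1 ?addr0.
  rewrite big_enum /= (eq_bigr (fun=> 1)) => [|u _]; first by rewrite sumr_const card_Fp.
  by rewrite klam_quad oppr_eq0 (negbTE a_neq0) invrN mulrN divff // opprK addNr mulr0 psi0.
move=> v va; rewrite big_enum /=; under eq_bigr do rewrite klam_quad.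
case: eqP => [_|/eqP v0]; first by rewrite big1.
apply: psi_lin_sum; apply: contra va => /eqP E.
apply/eqP; rewrite -[v]opprK; congr (- _).
transitivity (- (1 + (- 1 - a / v)) * v); first by rewrite E; ring.
by field.
Qed.

Section Ext.
Variables (m : nat) (L : finFieldType) (iota : {rmorphism 'F_p -> L}).
Hypotheses (m_gt0 : (0 < m)%N) (cardL : #|L| = (p ^ m)%N).
Local Notation tr := (tr iota p_pr m_gt0 cardL).

(** For the characteristic polynomial of [x != 0], [- subtop] and [- logder0] are the traces of [x]
    and of its inverse. *)
Lemma ssum_klam : ssum klam m = \sum_(x : L | x != 0) psi (tr (x + iota a / x)).
Proof.
have ex x : exists C, map_poly iota C == conj_prod p m x.
  have [|C <-] := @conj_prod_descend p L iota p_pr m x m_gt0; last by exists C.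
  by rewrite -cardL expf_card.
pose C x := xchoose (ex x).
have CE x : map_poly iota (C x) = conj_prod p m x by apply/eqP/(xchooseP (ex x)).
rewrite (ssum_field p_pr m_gt0 cardL klam1 klamM CE) [RHS]big_mkcond.
apply: eq_bigr => x _; have [->|x0] := eqVneq x 0.
  rewrite /klam -(fmorph_eq0 iota) -coef_map CE /conj_prod.
  rewrite -horner_coef0 horner_prod big_ltn //= hornerXsubC expr1 subrr mul0r eqxx //.
have [c0 c1] := @logder0_prod L m (fun i => x ^+ (p ^ i)) (fun i => expf_neq0 _ x0).
rewrite /klam -(fmorph_eq0 iota) -coef_map CE (negbTE c0); congr psi.
apply: (fmorph_inj iota); rewrite trE rmorphB rmorphN rmorphM /=.
rewrite -map_subtop -map_logder0 CE /conj_prod c1 subtop_prod (TraceD m iota p_pr) [X in _ = X]/= .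
rewrite opprK mulrN opprK !big_mkord.
congr (_ + _); rewrite /Trace mulr_sumr; apply: eq_bigr => i _.
rewrite exprMn exprVn; congr (_ * _).
elim: (val i) => [|k IH]; first by rewrite expr1.
by rewrite expnSr exprM -IH -rmorphXn Fp_expp.
Qed.
End Ext.

End KloostermanL.

(** * Weil's bound *)

Lemma prime_power_extension (p m : nat) : prime p -> (0 < m)%N ->
  exists (L : finFieldType) (iota : {rmorphism 'F_p -> L}), #|L| = (p ^ m)%N.
Proof.
move=> p_pr m0; have [L charL cardL] := PrimePowerField p_pr m0.
pose f : {rmorphism 'F_p -> pPrimeCharType charL} := in_alg (pPrimeCharType charL).
by exists L, f.
Qed.

(** The recurrence propagates the gain [e n.+2 - P * e n.+1 >= (T - 2 * P) * P ^+ n.+1], and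
    accumulating these gains produces the factor [n]. *)
Lemma linear_growth (R : numDomainType) (e : nat -> R) (T P : R) : 0 <= P ->
  2 * P <= T -> e 1 = T -> e 2 = T ^+ 2 - 2 * P ^+ 2 ->
  (forall n, (0 < n)%N -> e n.+2 = T * e n.+1 - P ^+ 2 * e n) ->
  forall n, (T - 2 * P) * n%:R * P ^+ n <= e n.+1.
Proof.
move=> P0 PT e1 e2 rec.
have T0 : 0 <= T by apply: le_trans PT; rewrite mulr_ge0.
have d0 : 0 <= T - 2 * P by rewrite subr_ge0.
suff H n : 0 <= e n.+1 /\ (T - 2 * P) * P ^+ n.+1 + P * e n.+1 <= e n.+2.
  elim=> [|n IH]; first by rewrite mulr0 mul0r e1.
  apply: le_trans (proj2 (H n)).
  rewrite -[n.+1%:R]natr1 mulrDr mulrDl mulr1 addrC lerD2l exprS mulrCA.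
  by rewrite ler_wpM2l.
elim: n => [|n [IH1 IH2]].
  rewrite e1 e2; split=> //; rewrite -subr_ge0.
  have -> : T ^+ 2 - 2 * P ^+ 2 - ((T - 2 * P) * P ^+ 1 + P * T) = (T - 2 * P) * T by ring.
  by rewrite mulr_ge0.
have h : 0 <= e n.+2.
  by apply: le_trans IH2; rewrite addr_ge0 // mulr_ge0 // exprn_ge0.
split=> //; rewrite (rec n.+1) // -subr_ge0.
have -> : T * e n.+2 - P ^+ 2 * e n.+1 - ((T - 2 * P) * P ^+ n.+2 + P * e n.+2) =
  (T - 2 * P) * e n.+2 + P * (e n.+2 - ((T - 2 * P) * P ^+ n.+1 + P * e n.+1)).
  by rewrite [P ^+ n.+2]exprS; ring.
by rewrite addr_ge0 // mulr_ge0 // subr_ge0.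
Qed.

Section Weil.
Variables (p : nat) (p_pr : prime p) (psi : 'F_p -> algC) (a : 'F_p).
Hypotheses (psi_norm : forall x, `|psi x| = 1) (psi_sum : \sum_x psi x = 0)
  (psiD : forall x y, psi (x + y) = psi x * psi y) (a_neq0 : a != 0).
Local Notation kl := (kl psi a).
Local Notation s := (ssum (klam psi a)).

Lemma kl_real : kl \is Num.real.
Proof.
apply/CrealP; rewrite /kl rmorph_sum /= (reindex_inj oppr_inj) /=.
apply: eq_big => x; first by rewrite oppr_eq0.
by move=> _; rewrite -psiN //; congr psi; rewrite invrN mulrN opprD !opprK.
Qed.

Lemma ssum_rec :
  [/\ s 1 = kl, s 2 = 2 * p%:R - kl ^+ 2 &
     forall n, (2 < n)%N -> s n = - kl * s n.-1 - p%:R * s n.-2].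
Proof.
have nw n := newton (klam1 a psi_norm psiD) (klamM a psiD) n.
have A0 := Asum0 (klam1 a psi_norm psiD).
have A1 := Asum_klam1 psi a.
have A2 := Asum_klam2 p_pr psi_norm psi_sum psiD a_neq0.
have s1 : s 1 = kl.
  by have := nw 1%N; rewrite big_nat1 subnn A0 mulr1 A1.
split=> //.
  have := nw 2%N; rewrite big_nat_recr // big_nat1 subnn A0 mulr1 A2 A1 s1.
  move=> E; have -> : s 2 = kl * kl + s 2 - kl * kl by ring.
  by rewrite -E mulr2n; ring.
case=> [|[|[|n]]] // _; have := nw n.+3.
rewrite (Asum_klam_gt2 p_pr psi_sum psiD a_neq0) // mul0rn; do 3!rewrite big_nat_recr //=.
rewrite big_nat_cond big1 ?add0r; last first.
  move=> m /andP[/andP[m1 mn] _]; rewrite (Asum_klam_gt2 p_pr psi_sum psiD a_neq0) ?mulr0 //; lia.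
rewrite subnn A0 subSnn A1 -[n.+3]/(2 + n.+1)%N addnK A2 mulr1 => E.
move: E; set u := s n.+1; set v := s n.+2; set w := s n.+3; move=> E.
have -> : w = u * p%:R + v * kl + w - v * kl - u * p%:R by ring.
by rewrite -E; ring.
Qed.

Lemma weil_bound : kl ^+ 2 <= 4 * p%:R.
Proof.
have [s1 s2 rec] := ssum_rec; pose P : algC := p%:R; pose T := kl ^+ 2 - 2 * P.
have P0 : 0 <= P by exact: ler0n.
have p0 : 0 < P by rewrite ltr0n prime_gt0.
have k2 : kl ^+ 2 \is Num.real by rewrite rpredX // kl_real.
rewrite real_leNgt //; last by rewrite rpredM // ?realn.
apply/negP => big.
(* If [alpha] and [beta] are the inverse roots of [1 + kl u + p u^2], this is
   [alpha^(2n) + beta^(2n)], with [T = alpha^2 + beta^2] and [P = alpha * beta]. *)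
pose e n := - s (2 * n).
have PT : 2 * P < T by rewrite ltrBrDr -mulrDl -natrD.
have e1 : e 1 = T by rewrite /e s2 /T /P; ring.
have e2 : e 2 = T ^+ 2 - 2 * P ^+ 2.
  by rewrite /e (rec 4%N) // (rec 3%N) //= s2 s1 /T /P; ring.
have erec n : (0 < n)%N -> e n.+2 = T * e n.+1 - P ^+ 2 * e n.
  case: n => // n _; rewrite /e.
  have -> : (2 * n.+3 = (2 * n).+2.+4)%N by lia.
  have -> : (2 * n.+2 = (2 * n).+4)%N by lia.
  have -> : (2 * n.+1 = (2 * n).+2)%N by lia.
  rewrite (rec (2 * n).+2.+4) // (rec (2 * n).+4.+1) //= (rec (2 * n).+4) //=.
  rewrite /T /P; ring.
have grow := linear_growth P0 (ltW PT) e1 e2 erec.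
have upper n : (0 < n)%N -> (p ^ 4 + 3 * p ^ 2 + 1 < p ^ n)%N ->
    e n <= ((4 * p ^ 2 + 2) * p ^ n)%:R.
  move=> n0 pn; have n20 : (0 < 2 * n)%N by rewrite muln_gt0.
  have [L [iota cardL]] := prime_power_extension p_pr n20.
  apply: le_trans (real_ler_norm _) _.
    apply: ger0_real; case: n n0 {pn n20 L iota cardL} => // n _.
    apply: le_trans (grow n); rewrite !mulr_ge0 ?exprn_ge0 ?ler0n //.
    by rewrite subr_ge0 ltW.
  rewrite normrN (ssum_klam p_pr a psi_norm psiD iota n20 cardL).
  apply: le_trans (kl_ext_bound iota p_pr n20 cardL pn a psi_norm psi_sum) _.
  rewrite ler_nat.
  have : (0 < p ^ n)%N by rewrite expn_gt0 prime_gt0.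
  move: pn; set q := (p ^ n)%N; nia.
have D0 : 0 < T - 2 * P by rewrite subr_gt0.
pose B : algC := ((4 * p ^ 2 + 2) * p)%:R / (T - 2 * P).
have B0 : 0 <= B by rewrite divr_ge0 ?ler0n // ltW.
(* The first summand makes linear growth beat the constant [4 * p ^ 2 + 2] of [upper]; the second
   makes [p ^ n.+1] large enough for the point count. *)
pose n := (Num.bound B + (p ^ 4 + 3 * p ^ 2 + 1))%N.
have pn : (p ^ 4 + 3 * p ^ 2 + 1 < p ^ n.+1)%N.
  apply: leq_ltn_trans (ltn_expl n.+1 (prime_gt1 p_pr)); rewrite /n; lia.
have := le_trans (grow n) (upper n.+1 isT pn).
rewrite (expnS p n) mulnA natrM [(p ^ n)%:R]natrX ler_pM2r ?exprn_gt0 //.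
rewrite -ler_pdivlMl // mulrC -/B => nB.
have := le_lt_trans nB (archi_boundP B0).
by rewrite ltr_nat /n ltnNge leq_addr.
Qed.

End Weil.

(** * Fourier analysis of the hyperbola in a box *)

Lemma additive_character (p : nat) : prime p -> exists psi : 'F_p -> algC,
  [/\ forall x, `|psi x| = 1, \sum_x psi x = 0 &
      forall x y, psi (x + y) = psi x * psi y].
Proof.
move=> p_pr; have p0 := prime_gt0 p_pr; have p1 := prime_gt1 p_pr.
have [z zp] := C_prim_root_exists p0.
pose psi (x : 'F_p) := z ^+ (x : nat).
have psiD x y : psi (x + y) = psi x * psi y.
  rewrite /psi -exprD -[RHS](prim_expr_mod zp); congr (_ ^+ _) => /=.
  by congr (_ %% _)%N; exact: Fp_cast.
have z1 : `|z| = 1.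
  apply/eqP; rewrite -(@pexpr_eq1 _ _ p) // -normrX (prim_expr_order zp) normr1 //.
exists psi; split=> //; first by move=> x; rewrite normrX z1 expr1n.
have E : \sum_x psi x = psi 1 * \sum_x psi x.
  rewrite {1}(reindex_inj (addrI (1 : 'F_p))) mulr_sumr.
  by apply: eq_bigr => x _; rewrite psiD.
have psi1 : psi 1 != 1.
  rewrite /psi /= -(prim_order_dvd zp) /= modn_small ?Fp_cast // dvdn1.
  by apply/eqP => pE; rewrite pE in p1.
apply/eqP; have : (psi 1 - 1) * \sum_x psi x == 0 by rewrite mulrBl mul1r -E subrr.
by rewrite mulf_eq0 subr_eq0 (negbTE psi1).
Qed.

Section Fourier.
Variables (p : nat) (p_pr : prime p) (psi : 'F_p -> algC).
Hypotheses (psi_norm : forall x, `|psi x| = 1) (psi_sum : \sum_x psi x = 0)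
  (psiD : forall x y, psi (x + y) = psi x * psi y).

Let P : algC := p%:R.
Let P_gt0 : 0 < P. Proof. by rewrite ltr0n prime_gt0. Qed.
Let P_neq0 : P != 0. Proof. exact: lt0r_neq0. Qed.

Definition weil_const : algC := 2 * sqrtC P.

Lemma weil_const_ge1 : 1 <= weil_const.
Proof.
have : 1 <= sqrtC P by rewrite -sqrtC1 ler_sqrtC ?ler1n ?prime_gt0 // qualifE /= ?ler0n.
move=> h; apply: (le_trans h); rewrite ler_peMl ?ler1n //.
by rewrite sqrtC_ge0 ltW.
Qed.

Definition Kl2 h k := \sum_(x : 'F_p | x != 0) psi (h * x + k / x).

Lemma Kl2_00 : Kl2 0 0 = P - 1.
Proof.
rewrite /Kl2 (eq_bigr (fun=> 1)); last by move=> x _; rewrite !mul0r addr0 psi0.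
rewrite sumr_const; have := cardC1 (0 : 'F_p); rewrite card_Fp // => cC.
rewrite (eq_card (B := predC1 0)) // cC.
by rewrite -subn1 natrB ?prime_gt0.
Qed.

Lemma psi_sum_neq0 : \sum_(x : 'F_p | x != 0) psi x = - 1.
Proof.
have := psi_sum; rewrite (bigD1 0) //= psi0 // addrC => /eqP.
by rewrite addr_eq0 => /eqP.
Qed.

(** If exactly one of [h], [k] vanishes, the sum is [- 1]; otherwise replacing [x] by [x / h] turns
    it into [kl psi (h * k)]. *)
Lemma Kl2_bound h k : (h != 0) || (k != 0) -> `|Kl2 h k| <= weil_const.
Proof.
have [->|h0] := eqVneq h 0; have [->|k0] := eqVneq k 0 => // _.
- have -> : Kl2 0 k = -1.
    rewrite -psi_sum_neq0 /Kl2.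
    have invol : involutive (fun x : 'F_p => k / x).
      move=> x; rewrite invf_div mulrCA divff ?mulr1 //.
    rewrite [RHS](reindex_inj (inv_inj invol)); apply: eq_big => x.
      by rewrite mulf_eq0 invr_eq0 (negbTE k0).
    by rewrite mul0r add0r.
  by rewrite normrN1 weil_const_ge1.
- have -> : Kl2 h 0 = -1.
    rewrite -psi_sum_neq0 /Kl2 [RHS](reindex_inj (mulfI h0)).
    apply: eq_big => x; first by rewrite mulf_eq0 (negbTE h0).
    by rewrite mul0r addr0.
  by rewrite normrN1 weil_const_ge1.
have -> : Kl2 h k = kl psi (h * k).
  rewrite /Kl2 /kl [RHS](reindex_inj (mulfI h0)).
  apply: eq_big => x; first by rewrite mulf_eq0 (negbTE h0).
  by move=> x0; congr psi; field; rewrite h0 x0.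
have hk : h * k != 0 by rewrite mulf_neq0.
have := weil_bound p_pr psi_norm psi_sum psiD hk.
have kr := kl_real (h * k) psi_norm psiD.
rewrite -[kl _ _ ^+ 2]real_normK // => bnd.
rewrite -(ler_pXn2r (n := 2)) // ?qualifE /= ?normr_ge0 //.
  by have -> : weil_const ^+ 2 = 4 * P by rewrite /weil_const exprMn sqrtCK; ring.
by rewrite mulr_ge0 // sqrtC_ge0 ltW.
Qed.

Definition geom_sum T h := \sum_(j < T) psi (h * j%:R).

Lemma ortho (u : 'F_p) : \sum_h psi (h * u) = P * (u == 0)%:R.
Proof.
have [->|u0] := eqVneq u 0; last by rewrite mulr0 psi_lin_sum.
rewrite mulr1 (eq_bigr (fun=> 1)) ?sumr_const ?card_Fp // => h _.
by rewrite mulr0 psi0.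
Qed.

Lemma natr_Fp_inj T (i j : 'I_T) : (T <= p)%N -> (i%:R == j%:R :> 'F_p) = (i == j).
Proof.
move=> Tp; apply/eqP/eqP => [|-> //] E; apply: val_inj => /=.
have := congr1 val E; rewrite /= !val_Fp_nat // !modn_small //; exact: leq_trans (ltn_ord _) Tp.
Qed.

Lemma geom_sumN T h : geom_sum T (- h) = (geom_sum T h)^*.
Proof. by rewrite /geom_sum rmorph_sum; apply: eq_bigr => j _; rewrite /= -psiN // mulNr. Qed.

Lemma geom_sum_parseval T : (T <= p)%N -> \sum_h `|geom_sum T h| ^+ 2 = P * T%:R.
Proof.
move=> Tp; transitivity (\sum_h \sum_(j < T) \sum_(i < T) psi (h * (j%:R - i%:R))).
  apply: eq_bigr => h _; rewrite normCK -geom_sumN /geom_sum mulr_suml; apply: eq_bigr => j _.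
  rewrite mulr_sumr; apply: eq_bigr => i _; rewrite -psiD; congr psi; ring.
rewrite exchange_big /=.
transitivity (\sum_(j < T) P); last by rewrite sumr_const card_ord mulr_natr.
apply: eq_bigr => j _; rewrite exchange_big /= (bigD1 j) //= [X in _ + X]big1.
  by rewrite ortho subrr eqxx mulr1 addr0.
move=> i ij; rewrite ortho subr_eq0 natr_Fp_inj // eq_sym (negbTE ij) mulr0 //.
Qed.

Variables (M : nat) (M2p : (2 * M <= p)%N).

(* At least [M] on [K, K + M - 1], with absolutely summable transform [Rf]. *)
Definition fejer (K x : 'F_p) : algC :=
  \sum_(j < 2 * M) \sum_(i < M) (x == K + j%:R - i%:R)%:R.

Definition Rf K h := psi (- (h * K)) * (geom_sum (2 * M) (- h) * geom_sum M h).

Lemma fejerE K x : fejer K x = P^-1 * \sum_h Rf K h * psi (h * x).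
Proof.
have -> : \sum_h Rf K h * psi (h * x) =
   \sum_(j < 2 * M) \sum_(i < M) \sum_h psi (h * (x - (K + j%:R - i%:R))).
  rewrite /Rf /geom_sum.
  under [RHS]eq_bigr do rewrite exchange_big /=.
  rewrite [RHS]exchange_big; apply: eq_bigr => h _.
  rewrite mulr_suml mulr_sumr mulr_suml; apply: eq_bigr => j _.
  rewrite !mulr_sumr mulr_suml; apply: eq_bigr => i _.
  by rewrite -!psiD; congr psi; ring.
rewrite /fejer mulr_sumr; apply: eq_bigr => j _; rewrite mulr_sumr; apply: eq_bigr => i _.
by rewrite ortho subr_eq0 mulKf.
Qed.

(** The inequality [2 u v <= u^2 + v^2] and Parseval for the lengths [2 * M] and [M] give
    [(2 * M + M) / 2]. *)
Lemma Rf_sum K : \sum_h `|Rf K h| <= P * (3 / 2 * M%:R).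
Proof.
have Mp : (M <= p)%N by apply: leq_trans M2p; rewrite leq_pmull.
apply: (@le_trans _ _ (\sum_h (`|geom_sum (2 * M) h| ^+ 2 + `|geom_sum M h| ^+ 2) / 2)).
  apply: ler_sum => h _; rewrite normrM psi_norm mul1r normrM geom_sumN norm_conjC.
  rewrite ler_pdivlMr // -subr_ge0.
  have -> : `|geom_sum (2 * M) h| ^+ 2 + `|geom_sum M h| ^+ 2 - `|geom_sum (2 * M) h| * `|geom_sum M h| * 2 =
     (`|geom_sum (2 * M) h| - `|geom_sum M h|) ^+ 2 by ring.
  by rewrite real_exprn_even_ge0 // rpredB // normr_real.
rewrite -mulr_suml big_split /= !geom_sum_parseval // natrM.
by rewrite le_eqVlt; apply/orP; left; apply/eqP; field.
Qed.

Lemma Rf0 K : Rf K 0 = 2 * M%:R ^+ 2.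
Proof.
have geom_sum0 T : geom_sum T 0 = T%:R.
  rewrite /geom_sum (eq_bigr (fun=> 1)) ?sumr_const ?card_ord // => j _; by rewrite mul0r psi0.
by rewrite /Rf oppr0 !geom_sum0 mul0r oppr0 psi0 // natrM; ring.
Qed.

(** Each [i' < M] represents the point as [K + (i + i') - i'], which is why the first range of
    [fejer] has length [2 * M]. *)
Lemma fejer_ge K (i : 'I_M) : M%:R <= fejer K (K + i%:R).
Proof.
rewrite /fejer exchange_big /= -[M in M%:R]card_ord -sum1_card natr_sum.
apply: ler_sum => i' _.
have h : (i + i' < 2 * M)%N by have := ltn_ord i; have := ltn_ord i'; lia.
rewrite (bigD1 (Ordinal h)) //= natrD addrA addrK eqxx ler_wpDr //.
by apply: sumr_ge0 => j _; rewrite ler0n.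
Qed.

Lemma fejer_ge0 K x : 0 <= fejer K x.
Proof. by apply: sumr_ge0 => j _; apply: sumr_ge0 => i _; rewrite ler0n. Qed.

Variables (K L lam : 'F_p) (lam_neq0 : lam != 0).

(** After expanding both weights, the sum over [x] is [Kl2 h (k * lam)]. The frequencies [h = k = 0]
    give the main term, the others at most [weil_const] times two factors bounded by [Rf_sum], and
    [(3 / 2)^2 = 9 / 4]. *)
Lemma fejer_count : \sum_(x | x != 0) fejer K x * fejer L (lam / x) <=
  4 * M%:R ^+ 4 / P + weil_const * (9 / 4 * M%:R ^+ 2).
Proof.
set N := \sum_(x | _) _; pose S := \sum_h \sum_k Rf K h * Rf L k * Kl2 h (k * lam).
have NE : N = P^-1 ^+ 2 * S.
  rewrite mulr_sumr.
  transitivity (\sum_(x : 'F_p | x != 0) \sum_h \sum_k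
     P^-1 ^+ 2 * (Rf K h * Rf L k * psi (h * x + (k * lam) / x))).
    apply: eq_bigr => x _; rewrite !fejerE mulrACA -expr2 mulr_suml mulr_sumr.
    apply: eq_bigr => h _; rewrite !mulr_sumr; apply: eq_bigr => k _.
    by rewrite psiD -[k * lam / x]mulrA; ring.
  rewrite exchange_big; apply: eq_bigr => h _ /=; rewrite exchange_big mulr_sumr.
  apply: eq_bigr => k _; rewrite -!mulr_sumr //.
have -> : 4 * M%:R ^+ 4 / P + weil_const * (9 / 4 * M%:R ^+ 2) =
   P^-1 ^+ 2 * ((2 * M%:R ^+ 2) * (2 * M%:R ^+ 2) * P +
      weil_const * (P * (3 / 2 * M%:R) * (P * (3 / 2 * M%:R)))).
  by field.
rewrite NE ler_pM2l ?exprn_gt0 ?invr_gt0 //.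
apply: le_trans (real_ler_norm _) _.
  have -> : S = P ^+ 2 * N by rewrite NE; field.
  apply/ger0_real/mulr_ge0; first by rewrite exprn_ge0 // ltW.
  by apply: sumr_ge0 => x _; rewrite mulr_ge0 ?fejer_ge0.
apply: (@le_trans _ _ (\sum_h \sum_k `|Rf K h| * `|Rf L k| * `|Kl2 h (k * lam)|)).
  apply: le_trans (ler_norm_sum _ _ _) _; apply: ler_sum => h _.
  by apply: le_trans (ler_norm_sum _ _ _) _; apply: ler_sum => k _; rewrite !normrM.
apply: (@le_trans _ _ (\sum_h \sum_k (((h == 0) && (k == 0))%:R *
   ((2 * M%:R ^+ 2) * (2 * M%:R ^+ 2) * P) + weil_const * (`|Rf K h| * `|Rf L k|)))).
  apply: ler_sum => h _; apply: ler_sum => k _.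
  have W0 : 0 <= weil_const by apply: le_trans weil_const_ge1.
  have [/andP[/eqP-> /eqP->]|] := boolP ((h == 0) && (k == 0)).
    rewrite mul1r mul0r Kl2_00 !Rf0; apply: ler_wpDr; first by apply: mulr_ge0 => //; apply: mulr_ge0; exact: normr_ge0.
    have M0 : 0 <= 2 * M%:R ^+ 2 :> algC by rewrite mulr_ge0 ?exprn_ge0 ?ler0n.
    rewrite !ger0_norm ?ler_wpM2l ?mulr_ge0 //; last first.
      by rewrite subr_ge0 ler1n prime_gt0.
    by rewrite gerBl.
  rewrite negb_and => hk; rewrite mul0r add0r mulrC ler_wpM2r ?mulr_ge0 //.
  by apply: Kl2_bound; rewrite mulf_eq0 (negbTE lam_neq0) orbF.
under eq_bigr do rewrite big_split /=.
rewrite big_split /=; apply: lerD.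
  rewrite (bigD1 0) //= (bigD1 0) //= mul1r.
  rewrite [X in _ + X + _]big1 => [|k k0]; last by rewrite (negbTE k0) mul0r.
  rewrite [X in _ + X]big1 => [|h h0]; first by rewrite !addr0.
  by rewrite big1 // => k _; rewrite (negbTE h0) mul0r.
under eq_bigr do rewrite -mulr_sumr -mulr_sumr.
rewrite -mulr_sumr -mulr_suml.
rewrite ler_wpM2l ?(le_trans ler01 weil_const_ge1) //.
by apply: ler_pM; rewrite ?sumr_ge0 ?Rf_sum.
Qed.

Definition hypbox := [set x : 'F_p | [&& x != 0,
  [exists i : 'I_M, x == K + i%:R] & [exists i : 'I_M, lam / x == L + i%:R]]].

(** Each point of the box counts at least [M ^ 2] in [fejer_count]. The resulting bound
    [p N <= 4 M^2 + (9/2) p^(3/2)] is squared into an inequality between natural numbers, which can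
    pass from [algC] to a real field. *)
Lemma hypbox_bound : (0 < M)%N ->
  (4 * (p * #|hypbox| - 4 * M ^ 2) ^ 2 <= 81 * p ^ 3)%N.
Proof.
move=> M0.
have N2 : 0 < M%:R ^+ 2 :> algC by rewrite exprn_gt0 // ltr0n.
have : #|hypbox|%:R * M%:R ^+ 2 <= 4 * M%:R ^+ 4 / P + weil_const * (9 / 4 * M%:R ^+ 2).
  apply: le_trans fejer_count.
  rewrite -sum1_card natr_sum mulr_suml big_mkcond [X in _ <= X]big_mkcond.
  apply: ler_sum => x _; rewrite inE.
  case: eqP => //= _; case: ifP => [/andP[/existsP[i /eqP->] /existsP[j /eqP ->]]|_].
    by rewrite mul1r expr2 ler_pM ?ler0n ?fejer_ge.
  by rewrite mulr_ge0 ?fejer_ge0.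
have -> : 4 * M%:R ^+ 4 / P + weil_const * (9 / 4 * M%:R ^+ 2) =
   (4 * M%:R ^+ 2 / P + weil_const * (9 / 4)) * M%:R ^+ 2 by field.
rewrite ler_pM2r // -(ler_pM2l P_gt0) mulrDr => bnd.
have [|lt] := leqP (p * #|hypbox|) (4 * M ^ 2).
  by rewrite -subn_eq0 => /eqP ->.
rewrite -(ler_nat algC) [(4 * _)%:R in X in X <= _]natrM [(81 * _)%:R]natrM.
rewrite [((_ - _) ^ 2)%:R]natrX [(p ^ 3)%:R]natrX natrB ?(ltnW lt) //.
have d0 : 0 <= (p * #|hypbox|)%:R - (4 * M ^ 2)%:R :> algC.
  by rewrite subr_ge0 ler_nat ltnW.
have : (p * #|hypbox|)%:R - (4 * M ^ 2)%:R <= P * (weil_const * (9 / 4)).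
  rewrite lerBlDl [(p * _)%:R]natrM [(4 * _)%:R]natrM [(M ^ 2)%:R]natrX; apply: (le_trans bnd).
  by rewrite le_eqVlt; apply/orP; left; apply/eqP; field.
move=> le; have : ((p * #|hypbox|)%:R - (4 * M ^ 2)%:R) ^+ 2 <= (P * (weil_const * (9 / 4))) ^+ 2.
  by rewrite lerXn2r // qualifE //= (le_trans d0 le).
move=> le2; have := ler_wpM2l (ler0n algC 4) le2.
move=> /le_trans; apply.
have -> : 4 * (P * (weil_const * (9 / 4))) ^+ 2 = 81 * P ^+ 2 * (sqrtC P) ^+ 2.
  by rewrite /weil_const; field.
by rewrite sqrtCK -mulrA -exprSr.
Qed.

End Fourier.

(** * The divisor bound *)

Lemma size_divisors_pfactor (q a m : nat) : prime q -> (0 < m)%N -> coprime q m ->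
  (size (divisors (m * q ^ a)) <= a.+1 * size (divisors m))%N.
Proof.
move=> q_pr m0 qm.
have q0 := prime_gt0 q_pr; have n0 : (0 < m * q ^ a)%N by rewrite muln_gt0 m0 expn_gt0 q0.
rewrite -(size_iota 0 a.+1) -(size_allpairs (fun i e => e * q ^ i)%N).
apply: uniq_leq_size (divisors_uniq _) _ => e; rewrite -dvdn_divisors // => en.
have e0 := dvdn_gt0 n0 en.
have [e' qe' eE] := pfactor_coprime q_pr e0.
apply/allpairsP; exists (logn q e, e'); split; last exact: eE.
  rewrite mem_iota add0n ltnS; have := dvdn_leq_log q n0 en.
  by rewrite lognM ?expn_gt0 ?q0 // pfactorK // (logn_coprime qm).
rewrite -dvdn_divisors //; have : (e' %| m * q ^ a)%N.
  by apply: dvdn_trans en; rewrite eE dvdn_mulr.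
by rewrite Gauss_dvdl // coprime_sym coprimeXl.
Qed.

Section DivisorBound.
Variable R : realType.
Implicit Types (eps : R).

(** Compare prime by prime. A factor [q ^ a] of [n] costs nothing once [q^eps >= 2], because
    [a.+1 <= 2 ^ a], and costs at most [K] for each of the at most [B] smaller primes. *)
Lemma divisor_bound eps : 0 < eps ->
  exists2 C : R, 0 < C &
   forall n : nat, (0 < n)%N -> (size (divisors n))%:R <= C * (n%:R `^ eps).
Proof.
move=> eps0.
pose t (q : nat) : R := q%:R `^ eps.
have tM m n : t (m * n)%N = t m * t n by rewrite /t natrM powRM ?ler0n.
have t1 : t 1%N = 1 by rewrite /t powR1.
have tX q a : t (q ^ a)%N = t q ^+ a.
  by elim: a => [|a IH]; rewrite ?expr0 // expnS tM IH exprS.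
have t_ge0 q : 0 <= t q by exact: powR_ge0.
have t_mono q r : (q <= r)%N -> t q <= t r.
  by move=> qr; rewrite /t ge0_ler_powR ?nnegrE ?ler0n ?ler_nat // ltW.
pose d := t 2%N - 1.
have d0 : 0 < d.
  by rewrite subr_gt0 -[X in X < _]t1 /t gt0_ltr_powR ?nnegrE ?ler0n ?ltr_nat.
have bern a : 1 + a%:R * d <= t 2%N ^+ a.
  elim: a => [|a IH]; first by rewrite mul0r addr0.
  rewrite exprS; apply: (@le_trans _ _ (t 2%N * (1 + a%:R * d))); last first.
    by rewrite ler_wpM2l.
  have -> : t 2%N = 1 + d by rewrite /d addrC subrK.
  rewrite -subr_ge0 -natr1.
  have -> : (1 + d) * (1 + a%:R * d) - (1 + (a%:R + 1) * d) = a%:R * (d * d) by ring.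
  by rewrite !mulr_ge0 // ltW.
(* By Bernoulli's inequality [q^(eps a) >= 1 + a d], and [(1 + 1 / d) (1 + a d) >= a + 1]. *)
pose K := 1 + d^-1.
have K0 : 0 < K by rewrite addr_gt0 ?invr_gt0.
have Ka a q : (1 < q)%N -> a.+1%:R <= K * t q ^+ a.
  move=> q1; apply: (@le_trans _ _ (K * (1 + a%:R * d))).
    rewrite -natr1 -subr_ge0 /K.
    have -> : (1 + d^-1) * (1 + a%:R * d) - (a%:R + 1) = d^-1 + a%:R * d.
      by field; rewrite gt_eqF.
    by rewrite addr_ge0 ?mulr_ge0 ?invr_ge0 ?(ltW d0).
  rewrite ler_pM2l // (le_trans (bern a)) // lerXn2r ?nnegrE //; exact: t_mono.
pose B := Num.bound (2 `^ eps^-1 : R).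
have Bq q : (B <= q)%N -> 2 <= t q.
  move=> Bq; apply: le_trans (t_mono _ _ Bq).
  have -> : (2 : R) = (2 `^ eps^-1) `^ eps.
    by rewrite -powRrM mulVf ?gt_eqF // powRr1.
  rewrite /t ge0_ler_powR ?nnegrE ?powR_ge0 ?ler0n //; first exact: ltW.
  by apply/ltW/archi_boundP/powR_ge0.
(* Passing from [b] to [b.+1] admits one more candidate for a small prime divisor, [B - b.+1], at
   the cost of one factor [K]. *)
have main b n : (0 < n)%N -> (forall q, prime q -> (q %| n)%N -> (B <= q + b)%N) ->
   (size (divisors n))%:R <= K ^+ b * t n.
  elim: b n => [|b IHb] n n0 nq.
    have [k] := ubnP n; elim: k n n0 nq => // k IH n n0 nq nk.
    have [n1|n1] := leqP n 1.
      have -> : n = 1%N by apply/eqP; rewrite eqn_leq n1.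
      by rewrite t1 mulr1.
    pose q := pdiv n; have q_pr : prime q by apply: pdiv_prime.
    have q0 := prime_gt0 q_pr; have q1 := prime_gt1 q_pr.
    have [m qm nE] := pfactor_coprime q_pr n0; set a := logn q n in nE.
    have a0 : (0 < a)%N by rewrite logn_gt0 mem_primes q_pr n0 pdiv_dvd.
    have m0 : (0 < m)%N by move: n0; rewrite nE muln_gt0 => /andP[].
    have qa : (1 < q ^ a)%N by rewrite -{1}(expn0 q) ltn_exp2l.
    have mn : (m < k)%N by rewrite -ltnS; apply: leq_ltn_trans nk; rewrite nE ltn_Pmulr.
    have mq r : prime r -> (r %| m)%N -> (B <= r + 0)%N.
      by move=> r_pr rm; apply: nq => //; rewrite nE dvdn_mulr.
    have := IH m m0 mq mn; rewrite expr0 !mul1r => IHm.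
    rewrite [X in t X]nE tM tX [X in divisors X]nE.
    apply: (@le_trans _ _ (a.+1 * size (divisors m))%:R).
      by rewrite ler_nat; apply: size_divisors_pfactor.
    rewrite natrM mulrC ler_pM ?ler0n //.
    apply: (@le_trans _ _ (2 ^+ a)); first by rewrite -natrX ler_nat ltn_expl.
    apply: lerXn2r; rewrite ?nnegrE ?ler0n //; apply: Bq.
    by have := nq q q_pr (pdiv_dvd n); rewrite addn0.
  pose q := (B - b.+1)%N.
  have Kb : 1 <= K by rewrite lerDl invr_ge0 ltW.
  have [qn|qn] := boolP ((q %| n)%N && prime q); last first.
    apply: (@le_trans _ _ (K ^+ b * t n)); last first.
      by rewrite ler_wpM2r // exprS ler_peMl // exprn_ge0 // ltW.
    apply: IHb => // r r_pr rn; have := nq r r_pr rn.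
    rewrite addnS leq_eqVlt ltnS => /orP[/eqP E|//].
    have rE : q = r by rewrite /q E; lia.
    by rewrite rE rn r_pr in qn.
  have /andP[qn' q_pr] := qn.
  have q0 := prime_gt0 q_pr; have q1 := prime_gt1 q_pr.
  have [m qm nE] := pfactor_coprime q_pr n0; set a := logn q n in nE.
  have m0 : (0 < m)%N by move: n0; rewrite nE muln_gt0 => /andP[].
  have mq r : prime r -> (r %| m)%N -> (B <= r + b)%N.
    move=> r_pr rm; have rn : (r %| n)%N by rewrite nE dvdn_mulr.
    have := nq r r_pr rn; rewrite addnS leq_eqVlt ltnS => /orP[/eqP E|//].
    have rE : q = r by rewrite /q E; lia.
    by move: qm; rewrite rE prime_coprime // rm.
  rewrite [X in t X]nE tM tX [X in divisors X]nE.
  apply: (@le_trans _ _ (a.+1 * size (divisors m))%:R).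
    by rewrite ler_nat; apply: size_divisors_pfactor.
  rewrite natrM exprS [t m * _]mulrC mulrACA.
  by rewrite ler_pM ?ler0n ?Ka ?IHb.
exists (K ^+ B); first by rewrite exprn_gt0.
by move=> n n0; apply: main => // q _ _; exact: leq_addl.
Qed.
End DivisorBound.

(** * Lattice points on hyperbolas *)

Lemma dvdz_sub (d m n : int) : (d %| m)%Z -> (d %| n)%Z -> (d %| m - n)%Z.
Proof. exact: rpredB. Qed.

Lemma norm4_lt (c1 c2 c3 c4 : int) (m n : nat) :
  `|c1| <= m%:Z -> `|c2| <= m%:Z -> `|c3| <= m%:Z -> `|c4| <= m%:Z -> (4 * m < n)%N ->
  `|c1 - c2 - c3 + c4| < n%:Z.
Proof. lia. Qed.

Section Elementary.
Variables (p M : nat) (k l lam : int).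
Hypothesis p_pr : prime p.

Definition pts : {set 'I_M * 'I_M} :=
  [set z : 'I_M * 'I_M | (p %| (k + (z.1 : nat)%:Z) * (l + (z.2 : nat)%:Z) - lam)%Z].

Lemma prime_dvdzM (a b : int) : (p %| a * b)%Z = (p %| a)%Z || (p %| b)%Z.
Proof. by rewrite !dvdzE abszM Euclid_dvdM. Qed.

Lemma small_dvdz (a : int) : `|a| < p%:Z -> (p %| a)%Z -> a = 0.
Proof.
move=> lt; rewrite dvdzE => /dvdn_leq; rewrite absz_gt0.
by case: eqP => // _ /(_ isT); lia.
Qed.

Hypothesis Mp : (M <= p)%N.

Lemma ord_eq (i j : 'I_M) : (p %| (i : nat)%:Z - (j : nat)%:Z)%Z -> i = j.
Proof.
move=> /small_dvdz h; apply: val_inj => /=.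
have := ltn_ord i; have := ltn_ord j => hj hi.
suff : (i : nat)%:Z - (j : nat)%:Z = 0 by lia.
by apply: h; lia.
Qed.

Hypothesis lam_cop : coprimez lam p.

Lemma lam_ndvd : ~~ (p %| lam)%Z.
Proof. by rewrite dvdzE -prime_coprime // coprime_sym -coprimezE. Qed.

Lemma pts_unit z : z \in pts -> ~~ (p %| k + (z.1 : nat)%:Z)%Z /\ ~~ (p %| l + (z.2 : nat)%:Z)%Z.
Proof.
rewrite inE => h; apply/andP; rewrite -negb_or -prime_dvdzM.
by apply: contra lam_ndvd => h'; move: (dvdz_sub h' h); rewrite opprB addrC subrK.
Qed.

Lemma pts_inj1 z z' : z \in pts -> z' \in pts -> z.1 = z'.1 -> z = z'.
Proof.
case: z z' => [i j] [i' j'] zp zp' /= ii'; subst i'; congr pair.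
have [/= ki _] := pts_unit zp; move: zp zp'; rewrite !inE /= => h h'.
apply: ord_eq; have := dvdz_sub h h'.
have -> : (k + (i : nat)%:Z) * (l + (j : nat)%:Z) - lam - ((k + (i : nat)%:Z) * (l + (j' : nat)%:Z) - lam) =
  (k + (i : nat)%:Z) * ((j : nat)%:Z - (j' : nat)%:Z) by ring.
by rewrite prime_dvdzM (negbTE ki).
Qed.

Lemma pts_inj2 z z' : z \in pts -> z' \in pts -> z.2 = z'.2 -> z = z'.
Proof.
case: z z' => [i j] [i' j'] zp zp' /= jj'; subst j'; congr pair.
have [/= _ lj] := pts_unit zp; move: zp zp'; rewrite !inE /= => h h'.
apply: ord_eq; have := dvdz_sub h h'.
have -> : (k + (i : nat)%:Z) * (l + (j : nat)%:Z) - lam - ((k + (i' : nat)%:Z) * (l + (j : nat)%:Z) - lam) =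
  ((i : nat)%:Z - (i' : nat)%:Z) * (l + (j : nat)%:Z) by ring.
by rewrite prime_dvdzM (negbTE lj) orbF.
Qed.

Lemma card_pts_le : (#|pts| <= M)%N.
Proof.
rewrite -[X in (_ <= X)%N]card_ord -(card_in_imset (f := fst)) ?max_card //.
by move=> z z' zp zp' E; exact: pts_inj1 E.
Qed.

Lemma card_le1 (T : finType) (A : {set T}) :
  (forall x y, x \in A -> y \in A -> x = y) -> (#|A| <= 1)%N.
Proof. by move=> h; apply/card_le1_eqP => x y xA yA; apply: h. Qed.

(** For [n != 0], the sign and the absolute value of the first factor, a divisor of [n], determine
    the first coordinate and thus the point; for [n = 0], each factor vanishes at one point of [A]
    at most. *)
Lemma hyp_count (A : {set 'I_M * 'I_M}) (t u v n : int) : A \subset pts -> t != 0 ->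
  (forall z, z \in A ->
    (t * (z.1 : nat)%:Z + v) * (t * (z.2 : nat)%:Z + u) = n) ->
  (#|A| <= 2 * size (divisors `|n|) + 2)%N.
Proof.
move=> /subsetP Ap t0 AE; have [n0|n0] := eqVneq n 0.
  pose A1 := [set z in A | t * (z.1 : nat)%:Z + v == 0].
  pose A2 := [set z in A | t * (z.2 : nat)%:Z + u == 0].
  have AU : A \subset A1 :|: A2.
    apply/subsetP => z zA; rewrite !inE zA /= -mulf_eq0 AE // n0 //.
  apply: leq_trans (subset_leq_card AU) _.
  apply: leq_trans (leq_card_setU _ _) _.
  have ordE (i i' : 'I_M) w : t * (i : nat)%:Z + w = 0 -> t * (i' : nat)%:Z + w = 0 -> i = i'.
    move=> E E'; apply: val_inj; apply/eqP; rewrite -eqz_nat.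
    have : t * ((i : nat)%:Z - (i' : nat)%:Z) = 0 by rewrite mulrBr; lia.
    by move/eqP; rewrite mulf_eq0 (negbTE t0) subr_eq0.
  have c1 : (#|A1| <= 1)%N.
    apply: card_le1 => z z'; rewrite !inE => /andP[zA /eqP E] /andP[zA' /eqP E'].
    by apply: pts_inj1 (Ap _ zA) (Ap _ zA') (ordE _ _ _ E E').
  have c2 : (#|A2| <= 1)%N.
    apply: card_le1 => z z'; rewrite !inE => /andP[zA /eqP E] /andP[zA' /eqP E'].
    by apply: pts_inj2 (Ap _ zA) (Ap _ zA') (ordE _ _ _ E E').
  by apply: leq_trans (leq_add c1 c2) _; rewrite leq_addl.
pose f (z : 'I_M * 'I_M) := t * (z.1 : nat)%:Z + v.
pose s := [seq (b, d) | b <- [:: true; false], d <- divisors `|n|].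
pose g z := (0 <= f z, `|f z|%N).
apply: (@leq_trans (size s)); last by rewrite size_allpairs /= leq_addr.
rewrite cardE -(size_map g); apply: uniq_leq_size.
  rewrite map_inj_in_uniq ?enum_uniq // => z z'; rewrite !mem_enum => zA zA' [E1 E2].
  have fE : f z = f z'.
    by move: E1 E2; case: (f z) (f z') => [a|a] [b|b] //= _ => [-> | [->]].
  apply: pts_inj1 (Ap _ zA) (Ap _ zA') _; apply: val_inj; apply/eqP; rewrite -eqz_nat.
  move/eqP: fE; rewrite /f -subr_eq0.
  have -> : t * (z.1 : nat)%:Z + v - (t * (z'.1 : nat)%:Z + v) =
     t * ((z.1 : nat)%:Z - (z'.1 : nat)%:Z) by ring.
  by rewrite mulf_eq0 (negbTE t0) subr_eq0.
move=> x /mapP[z]; rewrite mem_enum => zA ->; apply/allpairsP.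
exists (0 <= f z, `|f z|%N); split=> //=; first by case: (0 <= f z).
by rewrite -dvdn_divisors ?absz_gt0 // -(AE z zA) abszM dvdn_mulr.
Qed.

(* With one point as origin, two more determine the linear coefficients modulo
   [p] up to a factor [D]; the resulting congruence is an equality, for size
   reasons, and multiplication by [D] factors it. *)
Lemma small_box : (4 * M ^ 4 < p)%N ->
  exists2 n : nat, (n <= M ^ 6)%N & (#|pts| <= 2 * size (divisors n) + 2)%N.
Proof.
move=> Msmall; have [c2|] := leqP #|pts| 2.
  by exists 0%N => //; rewrite (leq_trans c2).
move=> c3; have [z0 z0p] : exists z0, z0 \in pts by apply/card_gt0P; lia.
have [z1] : exists z1, z1 \in pts :\ z0.
  by apply/card_gt0P; have := cardsD1 z0 pts; rewrite z0p; lia.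
rewrite in_setD1 => /andP[z10 z1p].
have [z2] : exists z2, z2 \in pts :\ z0 :\ z1.
  apply/card_gt0P; have := cardsD1 z0 pts; have := cardsD1 z1 (pts :\ z0).
  by rewrite z0p in_setD1 z10 z1p; lia.
rewrite !in_setD1 => /and3P[z21 z20 z2p].
pose X (z : 'I_M * 'I_M) : int := (z.1 : nat)%:Z - (z0.1 : nat)%:Z.
pose Y (z : 'I_M * 'I_M) : int := (z.2 : nat)%:Z - (z0.2 : nat)%:Z.
pose a := k + (z0.1 : nat)%:Z; pose b := l + (z0.2 : nat)%:Z.
have XE (z : 'I_M * 'I_M) : (z.1 : nat)%:Z = X z + (z0.1 : nat)%:Z by rewrite /X subrK.
have YE (z : 'I_M * 'I_M) : (z.2 : nat)%:Z = Y z + (z0.2 : nat)%:Z by rewrite /Y subrK.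
have eqn z : z \in pts -> (p %| X z * Y z + b * X z + a * Y z)%Z.
  move=> zp; move: (z0p) (zp); rewrite !inE => h0 h.
  have := dvdz_sub h h0; rewrite (XE z) (YE z); congr (_ %| _)%Z.
  by rewrite /a /b; ring.
have Mz : (0 < M%:Z :> int) by rewrite ltz_nat (leq_ltn_trans _ (ltn_ord z0.1)).
have XM z z' : `|X z - X z'| < M%:Z.
  by rewrite /X; have := ltn_ord z.1; have := ltn_ord z'.1; lia.
have YM z z' : `|Y z - Y z'| < M%:Z.
  by rewrite /Y; have := ltn_ord z.2; have := ltn_ord z'.2; lia.
have X0 : X z0 = 0 by rewrite /X subrr.
have Y0 : Y z0 = 0 by rewrite /Y subrr.
have XM0 z : `|X z| < M%:Z by have := XM z z0; rewrite X0 subr0.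
have YM0 z : `|Y z| < M%:Z by have := YM z z0; rewrite Y0 subr0.
(* Cramer's rule for the congruences [X * b + Y * a = - X * Y] at [z1] and [z2], with determinant
   [D]. *)
pose D := X z1 * Y z2 - X z2 * Y z1.
pose be := - (Y z1 * Y z2 * (X z1 - X z2)); pose ga := X z1 * X z2 * (Y z1 - Y z2).
have Db : (p %| D * b - be)%Z.
  have := dvdz_sub (dvdz_mull (Y z2) (eqn _ z1p)) (dvdz_mull (Y z1) (eqn _ z2p)).
  by congr (_ %| _)%Z; rewrite /D /be; ring.
have Da : (p %| D * a - ga)%Z.
  have := dvdz_sub (dvdz_mull (X z1) (eqn _ z2p)) (dvdz_mull (X z2) (eqn _ z1p)).
  by congr (_ %| _)%Z; rewrite /D /ga; ring.
have M1 : (M%:Z <= p%:Z :> int) by rewrite lez_nat.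
have nz (c : int) : `|c| < M%:Z -> c != 0 -> ~~ (p %| c)%Z.
  by move=> cM; apply: contra => /small_dvdz -> //; exact: lt_le_trans M1.
have Xneq z z' : z \in pts -> z' \in pts -> z != z' -> X z - X z' != 0.
  move=> zp zp'; apply: contra; rewrite /X opprB addrA subrK subr_eq0 eqz_nat => /eqP E.
  exact/eqP/(pts_inj1 zp zp')/val_inj.
have Yneq z z' : z \in pts -> z' \in pts -> z != z' -> Y z - Y z' != 0.
  move=> zp zp'; apply: contra; rewrite /Y opprB addrA subrK subr_eq0 eqz_nat => /eqP E.
  exact/eqP/(pts_inj2 zp zp')/val_inj.
have Y1 : Y z1 != 0 by have := Yneq _ _ z1p z0p z10; rewrite Y0 subr0.
have Y2 : Y z2 != 0 by have := Yneq _ _ z2p z0p z20; rewrite Y0 subr0.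
have X12 : X z1 - X z2 != 0 by apply: Xneq => //; rewrite eq_sym.
have D0 : D != 0.
  apply/negP => /eqP D0; move: Db; rewrite D0 mul0r sub0r /be opprK !prime_dvdzM.
  by rewrite !(negbTE (nz _ _ _)).
(* Expanded, this is a signed sum of four products of four factors, each at most [M] in absolute
   value, whence the condition [4 * M ^ 4 < p]. *)
have key z : z \in pts -> D * X z * Y z + be * X z + ga * Y z = 0.
  move=> zp; apply: small_dvdz; last first.
    have := dvdz_sub (dvdz_sub (dvdz_mull D (eqn z zp)) (dvdz_mull (X z) Db)) (dvdz_mull (Y z) Da).
    by congr (_ %| _)%Z; ring.
  have bnd (c d : int) (m n : nat) : `|c| <= m%:Z -> `|d| <= n%:Z -> `|c * d| <= (m * n)%N%:Z.
    by move=> hc hd; rewrite normrM PoszM ler_pM.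
  have XB z' : `|X z'| <= M%:Z by apply: ltW.
  have YB z' : `|Y z'| <= M%:Z by apply: ltW.
  have h1 := bnd _ _ _ _ (bnd _ _ _ _ (bnd _ _ _ _ (XB z1) (YB z2)) (XB z)) (YB z).
  have h2 := bnd _ _ _ _ (bnd _ _ _ _ (bnd _ _ _ _ (XB z2) (YB z1)) (XB z)) (YB z).
  have h3 := bnd _ _ _ _ (bnd _ _ _ _ (bnd _ _ _ _ (YB z1) (YB z2)) (ltW (XM z1 z2))) (XB z).
  have h4 := bnd _ _ _ _ (bnd _ _ _ _ (bnd _ _ _ _ (XB z1) (XB z2)) (ltW (YM z1 z2))) (YB z).
  have -> : D * X z * Y z + be * X z + ga * Y z =
    X z1 * Y z2 * X z * Y z - X z2 * Y z1 * X z * Y z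
    - Y z1 * Y z2 * (X z1 - X z2) * X z + X z1 * X z2 * (Y z1 - Y z2) * Y z.
    by rewrite /D /be /ga; ring.
  by apply: (norm4_lt h1 h2 h3 h4); move: Msmall; rewrite !expnS expn0 muln1 !mulnA.
pose n := be * ga.
exists `|n|%N.
  rewrite /n /be /ga mulNr abszN !abszM; have XN z : (`|X z| <= M)%N by rewrite -lez_nat abszE ltW.
  have YN z : (`|Y z| <= M)%N by rewrite -lez_nat abszE ltW.
  have XN2 : (`|(X z1 - X z2)%R| <= M)%N by rewrite -lez_nat abszE ltW.
  have YN2 : (`|(Y z1 - Y z2)%R| <= M)%N by rewrite -lez_nat abszE ltW.
  have -> : (M ^ 6 = M * M * M * (M * M * M))%N by rewrite !expnS expn0 muln1 !mulnA.
  by do !apply: leq_mul.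
apply: (@hyp_count pts D (be - D * (z0.2 : nat)%:Z) (ga - D * (z0.1 : nat)%:Z) n) => // z zp.
rewrite (XE z) (YE z).
have -> : (D * (X z + (z0.1 : nat)%:Z) + (ga - D * (z0.1 : nat)%:Z)) *
   (D * (Y z + (z0.2 : nat)%:Z) + (be - D * (z0.2 : nat)%:Z)) =
   D * (D * X z * Y z + be * X z + ga * Y z) + n by rewrite /n; ring.
by rewrite key // mulr0 add0r.
Qed.

(* For [p * w - mu] fixed, multiplication by [t] factors the equation. *)
Lemma box_count (t tau U Dm : nat) (u v : int) : (0 < t <= tau)%N ->
  `|u| <= U%:Z -> `|v| <= U%:Z -> (p %| t%:Z * l - u)%Z -> (p %| t%:Z * k - v)%Z ->
  (forall n, (n <= (tau * M + U) ^ 2)%N -> (size (divisors n) <= Dm)%N) ->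
  (#|pts| <= (2 * ((tau * M ^ 2 + 2 * M * U) %/ p + 1) + 1) * (2 * Dm + 2))%N.
Proof.
move=> /andP[t0 ttau] uU vU pu pv dm.
set V := (tau * M ^ 2 + 2 * M * U)%N; set Z := (V %/ p + 1)%N.
have p0 := prime_gt0 p_pr.
pose I (z : 'I_M * 'I_M) : int := (z.1 : nat)%:Z.
pose J (z : 'I_M * 'I_M) : int := (z.2 : nat)%:Z.
have IM z : 0 <= I z <= M%:Z by rewrite le0z_nat lez_nat ltnW.
have JM z : 0 <= J z <= M%:Z by rewrite le0z_nat lez_nat ltnW.
pose G z := t%:Z * (I z * J z) + u * I z + v * J z.
(* The constant term is reduced modulo [p]: since [|G z| <= V] and [mu < p], the quotient [w z] of
   [G z + mu] by [p] takes at most [2 * Z + 1] values. *)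
pose mu := ((t%:Z * (k * l - lam)) %% p)%Z.
have p0z : (p%:Z != 0) by rewrite eqz_nat -lt0n.
have mu_ge0 : 0 <= mu by apply: modz_ge0.
have mu_lt : mu < p%:Z by apply: ltz_pmod.
have GE z : z \in pts -> (p %| G z + mu)%Z.
  rewrite inE -/(I z) -/(J z) => zp.
  have h := dvdz_sub (dvdz_sub (dvdz_mull t%:Z zp) (dvdz_mull (I z) pu)) (dvdz_mull (J z) pv).
  have h2 : (p %| mu - t%:Z * (k * l - lam))%Z.
    by rewrite {1}(divz_eq (t%:Z * (k * l - lam)) p) -/mu opprD addrCA subrr addr0 -mulNr dvdz_mull.
  have := dvdz_sub h2 (dvdz_sub (dvdz0 p) h); congr (_ %| _)%Z; rewrite /G; ring.
pose w z := ((G z + mu) %/ p)%Z.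
have wE z : z \in pts -> G z = w z * p%:Z - mu.
  by move/GE/divzK => E; rewrite /w E addrK.
have GV z : `|G z| <= V%:Z.
  have /andP[I0 I1] := IM z; have /andP[J0 J1] := JM z.
  have i1 : `|I z| <= M%:Z by rewrite ger0_norm.
  have j1 : `|J z| <= M%:Z by rewrite ger0_norm.
  have -> : V%:Z = tau%:Z * (M%:Z * M%:Z) + U%:Z * M%:Z + U%:Z * M%:Z.
    by rewrite /V !PoszD !PoszM; ring.
  apply: le_trans (ler_normD _ _) _; apply: lerD; last by rewrite normrM ler_pM.
  apply: le_trans (ler_normD _ _) _; apply: lerD; last by rewrite normrM ler_pM.
  have ij : `|I z * J z| <= M%:Z * M%:Z by rewrite normrM ler_pM.
  by rewrite normrM; apply: ler_pM.
have wZ z : z \in pts -> `|w z| <= Z%:Z.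
  move=> zp; have pz : 0 < p%:Z by rewrite ltz_nat.
  rewrite -ltzD1 -(ltr_pM2r pz).
  have -> : `|w z| * p%:Z = `|G z + mu|.
    by rewrite (wE z zp) subrK normrM (ger0_norm (ltW pz)).
  apply: le_lt_trans (ler_normD _ _) _; rewrite (ger0_norm mu_ge0).
  have hV : V%:Z < (V %/ p + 1)%N%:Z * p%:Z.
    by rewrite -PoszM ltz_nat addn1 -ltn_divLR.
  rewrite mulrDl mul1r; apply: ler_ltD mu_lt; apply: le_trans (GV z) (ltW hV).
have shift_lt z : z \in pts -> (`|(w z + Z%:Z)%R| < (2 * Z).+1)%N.
  by move=> zp; have := wZ z zp; clear; move: (w z) => c; lia.
pose W z : 'I_(2 * Z).+1 := inord `|(w z + Z%:Z)%R|%N.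
have WE z z' : z \in pts -> z' \in pts -> W z = W z' -> w z = w z'.
  move=> zp zp'; have := wZ z zp; have := wZ z' zp'; rewrite !ler_norml => /andP[a1 a2] /andP[b1 b2].
  move/(congr1 val); rewrite /= !inordK.
  - move/(congr1 Posz); rewrite !gez0_abs; [exact: addIr | |].
      by rewrite -lerBlDr sub0r.
    by rewrite -lerBlDr sub0r.
  - exact: shift_lt.
  - exact: shift_lt.
rewrite -sum1_card (partition_big W predT) //=.
apply: (@leq_trans (\sum_(e : 'I_(2 * Z).+1) (2 * Dm + 2))); last first.
  by rewrite sum_nat_const card_ord addn1.
apply: leq_sum => e _.
pose A := [set z in pts | W z == e].
rewrite sum1_card -/pts (eq_card (B := A)); last by move=> z; rewrite [RHS]inE.
have [->|[z0 z0A]] := set_0Vmem A; first by rewrite cards0.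
have z0p : z0 \in pts by move: z0A; rewrite inE => /andP[].
have W0 : W z0 = e by move: z0A; rewrite inE => /andP[_ /eqP].
pose n := t%:Z * (w z0 * p%:Z - mu) + u * v.
have fact z : z \in A -> (t%:Z * (z.1 : nat)%:Z + v) * (t%:Z * (z.2 : nat)%:Z + u) = n.
  rewrite inE => /andP[zp /eqP Wz].
  have wz : w z = w z0 by apply: WE => //; rewrite Wz.
  by rewrite /n -wz -wE // /G /I /J; ring.
have Asub : A \subset pts by apply/subsetP => z; rewrite inE => /andP[].
apply: leq_trans (hyp_count Asub _ fact) _; first by rewrite eqz_nat -lt0n.
rewrite leq_add2r leq_pmul2l //; apply: dm.
have lin (x c : int) : 0 <= x <= M%:Z -> `|c| <= U%:Z -> (`|(t%:Z * x + c)%R| <= tau * M + U)%N.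
  move=> /andP[x0 xM] cU; rewrite -lez_nat abszE PoszD PoszM.
  apply: le_trans (ler_normD _ _) _; apply: lerD => //.
  by rewrite normrM ler_pM ?(ger0_norm x0).
by rewrite -(fact z0 z0A) abszM expnS expn1 leq_mul ?lin ?IM ?JM.
Qed.

Lemma rbox_subproof (T : nat) (x : int) : (0 < T)%N -> ((`|(x %% p)%Z| * T) %/ p < T)%N.
Proof.
move=> T0; have p0 := prime_gt0 p_pr; rewrite ltn_divLR // mulnC ltn_pmul2l //.
have p0z : (p%:Z != 0) by rewrite eqz_nat -lt0n.
by rewrite -ltz_nat gez0_abs ?modz_ge0 // ltz_pmod.
Qed.

(** Both residues lie in the same one of [T] boxes of length [p / T]; this is the pigeonhole input
    of Dirichlet's theorem. *)
Lemma rbox_eq (T : nat) (x y : int) : (0 < T)%N ->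
  ((`|(x %% p)%Z| * T) %/ p = (`|(y %% p)%Z| * T) %/ p)%N ->
  exists2 u : int, `|u| <= (p %/ T)%N%:Z & (p %| x - y - u)%Z.
Proof.
move=> T0 E; have p0 := prime_gt0 p_pr.
have p0z : (p%:Z != 0) by rewrite eqz_nat -lt0n.
exists ((x %% p)%Z - (y %% p)%Z); last first.
  have -> : x - y - ((x %% p)%Z - (y %% p)%Z) = ((x %/ p)%Z - (y %/ p)%Z) * p.
    by rewrite {1}(divz_eq x p) {1}(divz_eq y p); ring.
  exact: dvdz_mull.
have := modz_ge0 x p0z; have := modz_ge0 y p0z.
case: (x %% p)%Z E => // r; case: (y %% p)%Z => // r' /= E _ _.
have aux (r1 r2 : nat) : ((r1 * T) %/ p = (r2 * T) %/ p)%N -> (r1 - r2 <= p %/ T)%N.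
  move=> E'; rewrite leq_divRL // mulnBl leq_subLR.
  rewrite {1}(divn_eq (r1 * T) p) E' leq_add ?leq_trunc_div //.
  by rewrite ltnW // ltn_pmod.
have h1 := aux _ _ E; have h2 := aux _ _ (esym E).
by rewrite ler_norml; move: h1 h2; set q := (p %/ T)%N; clear; lia.
Qed.

Lemma dirichlet1 (T : nat) : (0 < T)%N -> exists (t : nat) (u : int),
  [/\ (0 < t <= T)%N, `|u| <= (p %/ T)%N%:Z & (p %| t%:Z * k - u)%Z].
Proof.
move=> T0; pose f (s : 'I_T.+1) : 'I_T := Ordinal (rbox_subproof ((s : nat)%:Z * k) T0).
have /injectivePn[s [s' ss' E]] : ~~ injectiveb f.
  by apply/negP => /injectiveP /leq_card; rewrite !card_ord ltnn.
wlog lt : s s' ss' E / (s' < s)%N.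
  move=> H; case: (ltngtP s s') => [lt|gt|eq]; [|exact: (H s s')|].
    by apply: (H s' s) => //; rewrite eq_sym.
  by case/eqP: ss'; apply: val_inj.
have [u uT pu] := rbox_eq T0 (congr1 val E).
exists (s - s')%N, u; split=> //; first by rewrite subn_gt0 lt (leq_trans (leq_subr _ _)) // -ltnS.
by rewrite -subzn ?(ltnW lt) // mulrBl.
Qed.

Lemma dirichlet2 (T : nat) : (0 < T)%N -> exists (t : nat) (u v : int),
  [/\ (0 < t <= T ^ 2)%N, `|u| <= (p %/ T)%N%:Z, `|v| <= (p %/ T)%N%:Z,
      (p %| t%:Z * l - u)%Z & (p %| t%:Z * k - v)%Z].
Proof.
move=> T0; pose f (s : 'I_(T ^ 2).+1) : 'I_T * 'I_T :=
  (Ordinal (rbox_subproof ((s : nat)%:Z * l) T0), Ordinal (rbox_subproof ((s : nat)%:Z * k) T0)).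
have /injectivePn[s [s' ss' E]] : ~~ injectiveb f.
  by apply/negP => /injectiveP /leq_card; rewrite card_prod !card_ord ltnn.
wlog lt : s s' ss' E / (s' < s)%N.
  move=> H; case: (ltngtP s s') => [lt|gt|eq]; [|exact: (H s s')|].
    by apply: (H s' s) => //; rewrite eq_sym.
  by case/eqP: ss'; apply: val_inj.
have [u uT pu] := rbox_eq T0 (congr1 (fun x => val x.1) E).
have [v vT pv] := rbox_eq T0 (congr1 (fun x => val x.2) E).
exists (s - s')%N, u, v; split=> //; last 2 first.
- by rewrite -subzn ?(ltnW lt) // mulrBl.
- by rewrite -subzn ?(ltnW lt) // mulrBl.
by rewrite subn_gt0 lt (leq_trans (leq_subr _ _)) // -ltnS.
Qed.

End Elementary.

(** * The estimates in the two ranges *)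

From mathcomp Require Import finmap boolp classical_sets functions cardinality.


Lemma I2_le_pts p M (lam K L : int) : (I2 p lam M K L <= #|pts p M (K + 1) (L + 1) lam|)%N.
Proof.
pose f (z : 'I_M * 'I_M) : int * int :=
  (K + 1 + (z.1 : nat)%:Z, L + 1 + (z.2 : nat)%:Z).
rewrite /I2 cardE -(size_map f); apply: uniq_leq_size; first exact: fset_uniq.
move=> [x y]; rewrite in_fset_set; last exact: finite_hyperbola_box.
rewrite inE => -[/= E xK yL].
have shift (A u : int) : A + 1 <= u <= A + M%:Z ->
    exists i : 'I_M, A + 1 + (i : nat)%:Z = u.
  move=> /andP[lo hi]; have iM : (`|(u - (A + 1))%R| < M)%N by lia.
  by exists (Ordinal iM) => /=; rewrite gez0_abs ?subr_ge0 // addrC subrK.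
have [i iE] := shift _ _ xK; have [j jE] := shift _ _ yL.
apply/mapP; exists (i, j); last by rewrite /f /= iE jE.
by rewrite mem_enum inE /= iE jE -eqz_mod_dvd; apply/eqP.
Qed.

Lemma pts_hypbox p M (k l lam : int) (p_pr : prime p) : (M <= p)%N -> coprimez lam p ->
  (#|pts p M k l lam| <= #|hypbox M (k%:~R : 'F_p) (l%:~R) (lam%:~R)|)%N.
Proof.
move=> Mp cop; pose f (z : 'I_M * 'I_M) : 'F_p := (k + (z.1 : nat)%:Z)%:~R.
have dv (c : int) : (c%:~R == 0 :> 'F_p) = (p %| c)%Z.
  by rewrite (dvdz_pcharf (pchar_Fp p_pr)).
rewrite -(card_in_imset (f := f)); last first.
  move=> z z' zp zp' /eqP; rewrite /f -subr_eq0 -rmorphB dv => h.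
  apply: (pts_inj1 p_pr Mp cop zp zp'); apply: (ord_eq p_pr Mp).
  by move: h; congr (_ %| _)%Z; ring.
apply: subset_leq_card; apply/fintype.subsetP => _ /imsetP[z zp ->].
have [h1 h2] := pts_unit p_pr cop zp.
have f0 : f z != 0 by rewrite /f dv.
rewrite inE f0 /=; apply/andP; split; apply/existsP.
  by exists z.1; rewrite /f rmorphD.
exists z.2; rewrite -(inj_eq (mulIf f0)) divfK // eq_sym -subr_eq0.
move: zp; rewrite inE -dv => /eqP; rewrite rmorphB rmorphM /= => E.
by apply/eqP; rewrite -[RHS]E mulrC /f; congr (_ * _ - _); rewrite [RHS]rmorphD.
Qed.

Section Analysis.
Variable R : realType.

Lemma powRD_gt0 (x a b : R) : 0 < x -> x `^ (a + b) = x `^ a * x `^ b.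
Proof. by move=> x0; rewrite powRD // lt0r_neq0 // implybT. Qed.

Lemma fourier_bound p M (k l lam : int) : prime p -> (0 < M)%N -> (M <= p)%N ->
  coprimez lam p ->
  (#|pts p M k l lam|%:R : R) <= 4 * (M%:R ^+ 2 / p%:R) + 9 / 2 * Num.sqrt p%:R.
Proof.
move=> p_pr M0 Mp cop.
have p0 : 0 < p%:R :> R by rewrite ltr0n prime_gt0.
have s0 : 0 <= 9 / 2 * Num.sqrt p%:R :> R by rewrite mulr_ge0 ?sqrtr_ge0 // divr_ge0.
have m0 : 0 < M%:R :> R by rewrite ltr0n.
(* The Fourier argument works for [2 * M <= p]; for larger [M] the trivial bound [M] is already
   below [4 * M ^ 2 / p]. *)
have [M2|M2] := leqP (2 * M) p; last first.
  apply: ler_wpDr => //; apply: (@le_trans _ _ M%:R); first by rewrite ler_nat card_pts_le.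
  rewrite mulrA ler_pdivlMr // expr2 mulrA [X in _ <= X]mulrC ler_pM2l //.
  have : (p <= 4 * M)%N by lia.
  by rewrite -(ler_nat R) natrM.
have [psi [psi_norm psi_sum psiD]] := additive_character p_pr.
have lam0 : (lam%:~R : 'F_p) != 0.
  by rewrite -(dvdz_pcharf (pchar_Fp p_pr)) lam_ndvd.
have := hypbox_bound p_pr psi_norm psi_sum psiD M2 k%:~R l%:~R lam0 M0.
set h := #|hypbox _ _ _ _| => hb.
apply: (@le_trans _ _ h%:R); first by rewrite ler_nat; exact: pts_hypbox.
rewrite -(ler_pM2l p0) mulrDr.
have -> : p%:R * (4 * (M%:R ^+ 2 / p%:R)) = 4 * M%:R ^+ 2 :> R by field; rewrite gt_eqF.
set d := (p * h - 4 * M ^ 2)%N in hb.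
have dE : p%:R * h%:R <= d%:R + 4 * M%:R ^+ 2 :> R.
  have : (p * h <= d + 4 * M ^ 2)%N by rewrite /d; lia.
  by rewrite -(ler_nat R) natrD [(p * h)%:R]natrM [(4 * _)%:R]natrM [(M ^ 2)%:R]natrX.
apply: (le_trans dE); rewrite addrC lerD2l.
have rhs0 : 0 <= p%:R * (9 / 2 * Num.sqrt p%:R) :> R by rewrite mulr_ge0 // ltW.
have four : 0 < 4 :> R by [].
rewrite -(ler_pXn2r (n := 2)) ?nnegrE ?ler0n // -(ler_pM2l four).
rewrite !exprMn sqr_sqrtr ?ler0n //.
have -> : 4 * (p%:R ^+ 2 * (9 ^+ 2 * 2^-1 ^+ 2 * p%:R)) = 81 * p%:R ^+ 3 :> R by field.
by move: hb; rewrite -(ler_nat R) [(4 * _)%:R]natrM [(81 * _)%:R]natrM [(d ^ 2)%:R]natrX [(p ^ 3)%:R]natrX.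
Qed.

(** [T] is the integer part of [X = (p / M)^(1 / (j + 1))], which balances [T ^ j * M ^ 2 / p]
    against [M / T]: with [X] for [T], both equal [M / X]. As [X <= 2 * T], rounding leaves
    [1 + 4 = 5]. *)
Lemma dirichlet_scale (j p M : nat) (be : R) : (0 < j)%N -> prime p -> (0 < M)%N -> (M <= p)%N ->
  M%:R `^ (1 - be) <= (p%:R / M%:R) `^ (j.+1%:R^-1) :> R ->
  exists T : nat, [/\ (0 < T)%N, (T ^ j <= p)%N &
    (T ^ j * M ^ 2 + 2 * M * (p %/ T))%N%:R / p%:R <= 5 * M%:R `^ be :> R].
Proof.
move=> j0 p_pr M0 Mp; set X := (_ / _) `^ _ => MX.
have p0 : 0 < p%:R :> R by rewrite ltr0n prime_gt0.
have m0 : 0 < M%:R :> R by rewrite ltr0n.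
have q1 : 1 <= p%:R / M%:R :> R by rewrite ler_pdivlMr // mul1r ler_nat.
have XX : X ^+ j.+1 = p%:R / M%:R.
  rewrite /X -powR_mulrn ?powR_ge0 // -powRrM mulVf ?pnatr_eq0 // powRr1 //.
  exact: le_trans q1.
have X1 : 1 <= X by rewrite /X -[X in X <= _](powRr0 (p%:R / M%:R)) ler_powR // invr_ge0.
have X0 : 0 < X by exact: lt_le_trans X1.
have mb : M%:R / X <= M%:R `^ be.
  rewrite ler_pdivrMr //; apply: (@le_trans _ _ (M%:R `^ be * M%:R `^ (1 - be))).
    by rewrite -powRD_gt0 // addrC subrK powRr1 // ltW.
  by rewrite ler_wpM2l ?powR_ge0.
pose T := Num.truncn X; exists T.
have TX : T%:R <= X by rewrite truncn_le // ltW.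
have XT : X < T.+1%:R by apply: truncnS_gt.
have T0 : (0 < T)%N by rewrite truncn_gt0.
have T0R : 0 < T%:R :> R by rewrite ltr0n.
have TjX : (T ^ j)%:R <= X ^+ j by rewrite natrX lerXn2r ?nnegrE ?ler0n // ltW.
split=> //.
  rewrite -(ler_nat R); apply: (le_trans TjX).
  apply: (@le_trans _ _ (X ^+ j.+1)); first by rewrite ler_weXn2l.
  by rewrite XX ler_pdivrMr // ler_peMr ?ler1n // ltW.
have -> : 5 * M%:R `^ be = M%:R `^ be + 4 * M%:R `^ be by ring.
rewrite natrD mulrDl; apply: lerD.
  apply: le_trans mb.
  have -> : M%:R / X = X ^+ j * M%:R ^+ 2 / p%:R.
    have -> : p%:R = X ^+ j.+1 * M%:R by rewrite XX divfK // gt_eqF.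
    by rewrite [X ^+ j.+1]exprS; field; rewrite !gt_eqF ?exprn_gt0.
  rewrite [(_ * _)%:R]natrM [(M ^ 2)%:R]natrX ler_pM2r ?invr_gt0 // ler_pM2r //.
  by rewrite exprn_gt0.
apply: (@le_trans _ _ (4 * (M%:R / X))); last by rewrite ler_pM2l.
rewrite !natrM ler_pdivrMr //.
have pT : (p %/ T)%N%:R <= p%:R / T%:R :> R.
  by rewrite ler_pdivlMr // -natrM ler_nat leq_trunc_div.
apply: (@le_trans _ _ (2 * M%:R * (p%:R / T%:R))); first by rewrite ler_wpM2l ?mulr_ge0 // ltW.
have TX2 : T%:R^-1 <= 2 * X^-1.
  rewrite -[2]invrK -invfM lef_pV2 ?posrE ?divr_gt0 ?mulr_gt0 ?invr_gt0 //.
  rewrite mulrC ler_pdivrMr //; apply: (le_trans (ltW XT)).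
  by rewrite -natrM ler_nat ?muln2 ?mul2n -addnn -addn1 leq_add2l.
have -> : 4 * (M%:R / X) * p%:R = (2 * M%:R * p%:R) * (2 * X^-1) by ring.
by rewrite mulrA ler_wpM2l ?mulr_ge0 // ltW.
Qed.

(** The exponent [be] is a parameter, so that both estimates of the theorem follow. A multiplier is
    demanded only if [p > M^(2 be)]; otherwise [sqrt p <= M^be] and the Fourier bound suffices. The
    three summands of [c] belong to the three cases of the proof. *)
Lemma pts_bound (eps : R) : 0 < eps -> exists2 c : R, 0 < c &
  forall (p M : nat) (k l lam : int) (be : R), 0 <= be -> prime p -> (0 < M)%N -> (M <= p)%N ->
    coprimez lam p ->
    (M%:R `^ (2 * be) < p%:R :> R -> exists (t tau U : nat) (u v : int),
      [/\ (0 < t <= tau)%N, (tau <= p)%N /\ (U <= p)%N, `|u| <= U%:Z /\ `|v| <= U%:Z,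
         (p %| t%:Z * l - u)%Z /\ (p %| t%:Z * k - v)%Z &
         (tau * M ^ 2 + 2 * M * U)%N%:R / p%:R <= 5 * M%:R `^ be :> R]) ->
    (#|pts p M k l lam|%:R : R) <= 4 * (M%:R ^+ 2 / p%:R) + c * M%:R `^ (be + eps).
Proof.
(* The divisor bound is applied to integers up to [1024 * M ^ 16], and [16 * e = eps]. *)
move=> eps0; pose e := eps / 16.
have e0 : 0 < e by rewrite divr_gt0.
have [Ce Ce0 dive] := divisor_bound e0.
pose C1 := Ce * 1024 `^ e.
have C10 : 0 < C1 by rewrite mulr_gt0 // powR_gt0.
exists ((2 * Ce + 2) + 13 * (2 * C1 + 2) + 9 / 2).
  by lra.
move=> p M k l lam be be0 p_pr M0 Mp cop H.
have m0 : 0 < M%:R :> R by rewrite ltr0n.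
have m1 : 1 <= M%:R :> R by rewrite ler1n.
have p0 : 0 < p%:R :> R by rewrite ltr0n prime_gt0.
set Q := M%:R `^ (be + eps).
have Q0 : 0 < Q by rewrite powR_gt0.
have main0 : 0 <= 4 * (M%:R ^+ 2 / p%:R) :> R.
  by rewrite mulr_ge0 // divr_ge0 ?exprn_ge0 // ltW.
have mono a : a <= be + eps -> M%:R `^ a <= Q by move=> h; rewrite /Q ler_powR.
(* [divisors 0] is [:: 1] *)
have divb (n : nat) (Y : R) : 1 <= Y -> n%:R <= Y -> (size (divisors n))%:R <= Ce * Y `^ e.
  move=> Y1; wlog n0 : n / (0 < n)%N => [gen|] nY.
    by have [n0|] := posnP n; [rewrite n0; apply: (gen 1%N) | move/gen; apply].
  apply: le_trans (dive n n0) _; rewrite ler_pM2l //.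
  by apply: ge0_ler_powR; rewrite ?nnegrE ?ler0n ?(le_trans _ nY) // ltW.
have c1 : 0 <= 2 * Ce + 2 :> R by lra.
have c2 : 0 <= 13 * (2 * C1 + 2) :> R by lra.
have Q1 : 1 <= Q.
  by rewrite /Q -[X in X <= _](powRr0 M%:R) ler_powR // addr_ge0 // ltW.
have [small|big] := ltnP (4 * M ^ 4) p.
  have [n nM cn] := small_box k l p_pr Mp cop small.
  apply: ler_wpDl => //; apply: (@le_trans _ _ ((2 * Ce + 2) * Q)); last first.
    by rewrite ler_pM2r // -addrA lerDl addr_ge0 // divr_ge0.
  apply: (@le_trans _ _ (2 * size (divisors n) + 2)%N%:R); first by rewrite ler_nat.
  rewrite natrD natrM [(_ + 2) * Q]mulrDl; apply: lerD; last by rewrite ler_peMr.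
  rewrite -mulrA ler_pM2l //; apply: le_trans (divb n (M%:R ^+ 6) _ _) _; first exact: exprn_ege1.
    by rewrite -natrX ler_nat.
  rewrite ler_pM2l // -powR_mulrn ?ler0n // -powRrM; apply: mono.
  by rewrite /e; lra.
have [lt|ge] := ltP (M%:R `^ (2 * be)) (p%:R : R); last first.
  apply: le_trans (fourier_bound _ _ p_pr M0 Mp cop) _; rewrite lerD2l.
  apply: (@le_trans _ _ (9 / 2 * Q)); last by rewrite ler_pM2r // lerDr addr_ge0.
  rewrite ler_pM2l ?divr_gt0 //; apply: (@le_trans _ _ (M%:R `^ be)); last first.
    by apply: mono; rewrite lerDl ltW.
  rewrite -(ger0_norm (powR_ge0 M%:R be)) -sqrtr_sqr ler_wsqrtr //.
  by rewrite -powR_mulrn ?powR_ge0 // -powRrM mulrC.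
have [t [tau [U [u [v [t_tau [taup Up] [uU vU] [pu pv] V]]]]]] := H lt.
pose Y := C1 * M%:R `^ eps.
have Y0 : 0 <= Y by rewrite mulr_ge0 ?powR_ge0 // ltW.
have YQ : (M%:R `^ be) * (2 * Y + 2) <= (2 * C1 + 2) * Q.
  have -> : Q = M%:R `^ be * M%:R `^ eps by rewrite /Q powRD_gt0.
  have b0 := powR_ge0 M%:R be.
  have : M%:R `^ be <= M%:R `^ be * M%:R `^ eps.
    by rewrite ler_peMr // -[X in X <= _](powRr0 M%:R) ler_powR // ltW.
  rewrite /Y; move: (M%:R `^ be) (M%:R `^ eps) => x y; nra.
have dm n : (n <= (tau * M + U) ^ 2)%N -> (size (divisors n) <= Num.truncn Y)%N.
  move=> nle; rewrite truncn_ge_nat //.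
  (* Here [p <= 4 * M ^ 4], so [tau * M + U <= 2 * p * M <= 8 * M ^ 5] and the square is polynomial
     in [M]. *)
  have nY : n%:R <= (1024 * M%:R ^+ 16 : R).
    have : (n <= 1024 * M ^ 16)%N.
      have pM : (p * M <= 4 * M ^ 5)%N by rewrite [(M ^ 5)%N]expnSr mulnA leq_mul2r big orbT.
      have h : (tau * M + U <= 8 * M ^ 5)%N.
        apply: (@leq_trans (p * M + p * M)); last by rewrite addnn -muln2 mulnC -(mulnA 2 4) leq_mul2l.
        by rewrite leq_add ?leq_mul2r ?taup ?orbT // (leq_trans Up) // leq_pmulr.
      apply: (leq_trans nle); apply: (@leq_trans ((8 * M ^ 5) ^ 2)); first by rewrite leq_exp2r.
      by rewrite expnMn -expnM leq_mul // leq_pexp2l.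
    by rewrite -(ler_nat R) natrM natrX.
  have one_le : 1 <= (1024 * M%:R ^+ 16 : R).
    by rewrite mulr_ege1 ?exprn_ege1 // ler1n.
  apply: le_trans (divb _ _ one_le nY) _; rewrite /Y /C1 -mulrA ler_pM2l //.
  rewrite powRM ?exprn_ge0 ?ler0n // -powR_mulrn ?ler0n // -powRrM.
  by have -> : 16 * e = eps by rewrite /e; field.
have := box_count p_pr Mp cop t_tau uU vU pu pv dm.
rewrite -(ler_nat R) => bc; apply: ler_wpDl => //; apply: (le_trans bc).
apply: (@le_trans _ _ (13 * (2 * C1 + 2) * Q)); last first.
  by rewrite ler_pM2r //; lra.
(* The factor 13 comes from [2 * (5 * x + 1) + 1 <= 13 * x] for [x >= 1]. *)
rewrite natrM; apply: (@le_trans _ _ (13 * M%:R `^ be * (2 * Y + 2))).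
  apply: ler_pM; rewrite ?ler0n //; last first.
    by rewrite natrD natrM lerD2r ler_pM2l // truncn_le.
  rewrite natrD natrM natrD.
  have b1 : 1 <= M%:R `^ be :> R by rewrite -[X in X <= _](powRr0 M%:R) ler_powR.
  have : ((tau * M ^ 2 + 2 * M * U) %/ p)%N%:R <= 5 * M%:R `^ be :> R.
    apply: le_trans V; rewrite ler_pdivlMr // -natrM ler_nat; exact: leq_trunc_div.
  move: (M%:R `^ be) b1 => x b1; lra.
by rewrite -!mulrA ler_pM2l //.
Qed.

End Analysis.

Theorem corollary1 (R : realType) :
  exists2 C : R, 0 < C &
    forall eps : R, 0 < eps ->
      exists (p0 : nat) (c : R), 0 < c /\
        forall (p M : nat) (lam K L : int),
          prime p -> (p0 <= p)%N -> (1 <= M <= p)%N -> coprimez lam p ->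
          (I2 p lam M K L)%:R
            <= C * (M%:R ^+ 2 / p%:R) + c * (M%:R `^ (4 / 5 + eps)) /\
          (K = L ->
           (I2 p lam M L L)%:R
             <= C * (M%:R ^+ 2 / p%:R) + c * (M%:R `^ (3 / 4 + eps))).
Proof.
(* The two Fejer weights have total mass [2 * M ^ 2] each, and their product is at least [M ^ 2] on
   the box; the ratio gives [4 * M ^ 2 / p]. *)
exists 4 => // eps eps0; have [c c0 fin] := pts_bound eps0.
exists 0%N, c; split=> // p M lam K L p_pr _ /andP[M0 Mp] cop.
have p0 : 0 < p%:R :> R by rewrite ltr0n prime_gt0.
have m0 : 0 < M%:R :> R by rewrite ltr0n.
(* The origin of the exponents: the premise of [dirichlet_scale] must hold as soon as
   [p > M^(2 be)]. Equality at [p = M^(2 be)] means [be = (j + 2) / (j + 3)], which is [4 / 5] when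
   two multiples have to be small and [3 / 4] when one has. *)
have quot j (be : R) : M%:R `^ (2 * be) < p%:R -> 2 * be - 1 = (1 - be) * j.+1%:R ->
    M%:R `^ (1 - be) <= (p%:R / M%:R) `^ (j.+1%:R^-1) :> R.
  move=> lt E; have -> : M%:R `^ (1 - be) = (M%:R `^ (2 * be - 1)) `^ (j.+1%:R^-1).
    by rewrite -powRrM E mulfK // pnatr_eq0.
  apply: ge0_ler_powR; rewrite ?nnegrE ?powR_ge0 ?invr_ge0 ?ler0n ?divr_ge0 //.
  rewrite ler_pdivlMr // -{2}[M%:R](powRr1 (ltW m0)) -powRD_gt0 //.
  by rewrite subrK ltW.
split.
  apply: le_trans (_ : #|pts p M (K + 1) (L + 1) lam|%:R <= _).
    by rewrite ler_nat I2_le_pts.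
  apply: fin => // [|lt]; first by lra.
  have [|T [T0 Tp TV]] := @dirichlet_scale R 2 p M (4 / 5) isT p_pr M0 Mp; first by apply: quot => //; lra.
  have [t [u [v [tT uT vT pu pv]]]] := dirichlet2 (K + 1) (L + 1) p_pr T0.
  by exists t, (T ^ 2)%N, (p %/ T)%N, u, v; split; rewrite ?leq_div.
move=> _.
apply: le_trans (_ : #|pts p M (L + 1) (L + 1) lam|%:R <= _).
  by rewrite ler_nat I2_le_pts.
apply: fin => // [|lt]; first by lra.
have [|T [T0 Tp TV]] := @dirichlet_scale R 1 p M (3 / 4) isT p_pr M0 Mp; first by apply: quot => //; lra.
have [t [u [tT uT pu]]] := dirichlet1 (L + 1) p_pr T0.
rewrite expn1 in Tp TV.
by exists t, T, (p %/ T)%N, u, u; split; rewrite ?leq_div.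
Qed.
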